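(* Let $k$ and $r$ be two positive integers with $r<k$, and let $G$ be a connected graph of order $n$ with minimum degree $\delta(G)=\delta$ and $$n\geq\max\Big\{\frac{(k+r)(k+2r)(k\delta+k+r)}{k^{2}r},\ \frac{(k^{2}+2kr)\delta^{2}+(2k^{2}+3kr+2r^{2})\delta+k^{2}+3kr}{2r(k-r)}\Big\}.$$ If $$q(G)\geq q\Big(K_{\delta}\vee\Big(K_{n-\lfloor\frac{k\delta}{r}\rfloor-\delta-1}\cup\Big(\Big\lfloor\frac{k\delta}{r}\Big\rfloor+1\Big)K_1\Big)\Big),$$ then $G$ has a $\{C_{2i+1},T:1\leq i<\frac{r}{k-r},\,T\in\mathcal{T}_{\frac{k}{r}}\}$-factor unless $G=K_{\delta}\vee(K_{n-\lfloor\frac{k\delta}{r}\rfloor-\delta-1}\cup(\lfloor\frac{k\delta}{r}\rfloor+1)K_1)$.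
   Context: All graphs are finite and undirected, without loops or multiple edges. The order of a graph is its number of vertices; $V(G)$, $E(G)$ are the vertex set and edge set of $G$. $q(G)$ denotes the signless Laplacian spectral radius of $G$, i.e. the largest eigenvalue of the signless Laplacian matrix $Q(G)=D(G)+A(G)$, where $A(G)$ is the adjacency matrix and $D(G)$ is the diagonal matrix of vertex degrees. $K_m$ is the complete graph of order $m$, and $C_m$ is the circuit (cycle) of order $m$. $G_1\cup G_2$ is the (disjoint) union of $G_1$ and $G_2$, $mK_1$ is the union of $m$ copies of $K_1$ ($m$ isolated vertices), and the join $G_1\vee G_2$ is obtained from $G_1\cup G_2$ by joining each vertex of $G_1$ with each vertex of $G_2$ by an edge. Equality of graphs means isomorphism. $\lfloor c\rfloor$ is the greatest integer not exceeding $c$. $i(G)$ denotes the number of isolated vertices of $G$. $G-S$ is the subgraph induced by $V(G)\setminus S$, and $T-e$ is $T$ with the edge $e$ deleted. A tree is a connected graph without circuits. For positive integers $r<k$, $\mathcal{T}_{\frac{k}{r}}$ denotes the set of trees $T$ such that (1) $i(T-S)\leq\frac{k}{r}|S|$ for any $S\subset V(T)$ (including $S=\emptyset$), and (2) for any $e\in E(T)$ there exists a set $S^{*}\subset V(T)$ (possibly empty) with $i((T-e)-S^{*})>\frac{k}{r}|S^{*}|$. For a set $\mathcal{H}$ of connected graphs, an $\mathcal{H}$-factor of $G$ is a subgraph $H$ of $G$ with $V(H)=V(G)$ such that each component of $H$ is isomorphic to an element of $\mathcal{H}$. The $\{C_{2i+1},T:1\leq i<\frac{r}{k-r},\,T\in\mathcal{T}_{\frac{k}{r}}\}$-factor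 is the case where $\mathcal{H}$ consists of all odd cycles $C_{2i+1}$ with $i$ an integer satisfying $1\leq i<\frac{r}{k-r}$, together with all trees $T\in\mathcal{T}_{\frac{k}{r}}$. *)

(* Defs.v *)
From HB Require Import structures.
From mathcomp Require Import all_boot all_order all_algebra.
From mathcomp Require Import classical_sets reals.

Set Implicit Arguments.
Unset Strict Implicit.
Unset Printing Implicit Defensive.

Import Order.TTheory GRing.Theory Num.Theory.

Local Open Scope ring_scope.

Record sgraph := SGraph {
  vertex :> finType;
  adj : rel vertex;
  adj_sym : symmetric adj;
  adj_irrefl : irreflexive adj }.

Definition isomorphic (G H : sgraph) : Prop :=
  exists2 f : G -> H, bijective f & forall x y, adj (f x) (f y) = adj x y.

Section Operations.
Variable G : sgraph.

Definition edges : {set {set G}} :=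
  [set e | [exists x, [exists y, adj x y && (e == [set x; y])]]].

Definition degree (x : G) : nat := #|[set y | adj x y]|.

(* Every degree is less than #|G|, so the default value is never attained
   when G has a vertex. *)
Definition min_degree : nat := \big[minn/#|G|]_(x : G) degree x.

Definition num_isolated : nat := #|[set x : G | degree x == 0%N]|.

Definition connected_graph : Prop :=
  (0 < #|G|)%N /\ forall x y : G, connect (@adj G) x y.

Definition acyclic_graph : Prop :=
  forall c : seq G, (2 < size c)%N -> ~ ucycle (@adj G) c.

Definition is_tree : Prop := connected_graph /\ acyclic_graph.

Section Induced.
Variable A : {set G}.

Definition induced_adj : rel {x : G | x \in A} :=
  fun x y => adj (val x) (val y).

Lemma induced_sym : symmetric induced_adj.
Proof. by move=> x y; rewrite /induced_adj adj_sym. Qed.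

Lemma induced_irrefl : irreflexive induced_adj.
Proof. by move=> x; rewrite /induced_adj adj_irrefl. Qed.

Definition induced : sgraph := SGraph induced_sym induced_irrefl.

End Induced.

Definition remove_vertices (S : {set G}) : sgraph := induced (~: S).

Definition component (x : G) : sgraph :=
  induced [set y | connect (@adj G) x y].

Section Spanning.
Variable E : {set {set G}}.

Definition spanning_adj : rel G := fun x y => adj x y && ([set x; y] \in E).

Lemma spanning_sym : symmetric spanning_adj.
Proof. by move=> x y; rewrite /spanning_adj adj_sym finset.setUC. Qed.

Lemma spanning_irrefl : irreflexive spanning_adj.
Proof. by move=> x; rewrite /spanning_adj adj_irrefl. Qed.

Definition spanning_subgraph : sgraph := SGraph spanning_sym spanning_irrefl.

End Spanning.

Definition remove_edge (e : {set G}) : sgraph := spanning_subgraph (edges :\ e).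

End Operations.

Section Complete.
Variable m : nat.

Definition complete_adj : rel 'I_m := fun i j => i != j.

Lemma complete_sym : symmetric complete_adj.
Proof. by move=> i j; rewrite /complete_adj eq_sym. Qed.

Lemma complete_irrefl : irreflexive complete_adj.
Proof. by move=> i; rewrite /complete_adj eqxx. Qed.

Definition complete_graph : sgraph := SGraph complete_sym complete_irrefl.

Definition edgeless_adj : rel 'I_m := fun _ _ => false.

Definition edgeless_graph : sgraph :=
  @SGraph 'I_m edgeless_adj (fun _ _ => erefl) (fun _ => erefl).

(* This is the circuit C_m only for 3 <= m. *)
Definition cycle_adj : rel 'I_m :=
  fun i j => (i != j) && ((j == ordS i) || (i == ordS j)).

Lemma cycle_sym : symmetric cycle_adj.
Proof. by move=> i j; rewrite /cycle_adj eq_sym orbC. Qed.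

Lemma cycle_irrefl : irreflexive cycle_adj.
Proof. by move=> i; rewrite /cycle_adj eqxx. Qed.

Definition cycle_graph : sgraph := SGraph cycle_sym cycle_irrefl.

End Complete.

Section UnionJoin.
Variables G H : sgraph.

(* b is the adjacency between a vertex of G and a vertex of H. *)
Definition sum_adj (b : bool) : rel (G + H)%type := fun u v =>
  match u, v with
  | inl x, inl y => adj x y
  | inr x, inr y => adj x y
  | _, _ => b
  end.

Lemma sum_sym b : symmetric (sum_adj b).
Proof. by case=> x [] y //=; apply: adj_sym. Qed.

Lemma sum_irrefl b : irreflexive (sum_adj b).
Proof. by case=> x /=; apply: adj_irrefl. Qed.

Definition union_graph : sgraph := SGraph (sum_sym false) (sum_irrefl false).

Definition join_graph : sgraph := SGraph (sum_sym true) (sum_irrefl true).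

End UnionJoin.

Section Spectrum.
Variables (R : realType) (G : sgraph).

Definition degree_matrix : 'M[R]_#|G| :=
  diag_mx (\row_i (degree (enum_val i))%:R).

Definition adjacency_matrix : 'M[R]_#|G| :=
  \matrix_(i, j) (adj (enum_val i) (enum_val j))%:R.

Definition signless_laplacian : 'M[R]_#|G| := degree_matrix + adjacency_matrix.

(* A real symmetric matrix of positive size has finitely many, and at least
   one, real eigenvalues, so this supremum is their maximum. *)
Definition q_radius : R :=
  sup [set x : R | eigenvalue signless_laplacian x]%classic.

End Spectrum.

Definition isolated_bound (k r : nat) (G : sgraph) (S : {set G}) : bool :=
  (num_isolated (remove_vertices S))%:R <= k%:R / r%:R * #|S|%:R :> rat.

Definition tree_class (k r : nat) (T : sgraph) : Prop :=
  [/\ is_tree T,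
      forall S : {set T}, isolated_bound k r S
    & forall e : {set T}, e \in edges T ->
        exists S : {set remove_edge e}, ~~ isolated_bound k r S].

Definition has_factor (F : sgraph -> Prop) (G : sgraph) : Prop :=
  exists2 E : {set {set G}}, E \subset edges G &
    forall x : spanning_subgraph E,
      exists2 H : sgraph, F H & isomorphic (component x) H.

Definition cycle_tree_family (k r : nat) (H : sgraph) : Prop :=
  (exists i : nat, [/\ (1 <= i)%N, i%:R < r%:R / (k%:R - r%:R) :> rat
                     & H = cycle_graph (2 * i + 1)])
  \/ tree_class k r H.

Definition extremal_graph (k r n d : nat) : sgraph :=
  join_graph (complete_graph d)
    (union_graph (complete_graph (n - (k * d) %/ r - d - 1))
                 (edgeless_graph ((k * d) %/ r + 1))).

(* Main.v *)
From mathcomp Require Import boolp classical_sets.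
Require Import Defs.
From mathcomp Require Import complex spectral sesquilinear.
From mathcomp Require Import all_boot all_order all_algebra.
From mathcomp Require Import reals.
From mathcomp Require Import zify ring lra.

(** The theorem has a combinatorial and a spectral half, joined by the condition
    that G - S has at most (k/r)|S| isolated vertices for every S.

    Combinatorial half ([isolated_bound_factor]): the condition gives the factor.
    It amounts to r|X| <= k|N(X)| for all vertex sets X ([isolated_expanding]),
    which is a Hall condition on the bipartite double cover, so it is equivalent
    to the existence of nonnegative edge weights with sum between r and k at each
    vertex ([factor_exists], [factor_expanding]).  Take a minimal spanning
    subgraph that satisfies it, and weights w for it; all weights are positive.
    A nonzero vector z on the edges with zero sum at every vertex would allow w to be
    moved along z until an edge vanishes, against minimality
    ([no_negative_circulation]).  Comparing the number of unknowns with the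
    number of equations, a component has at most as many edges as vertices, and
    fewer when it has a leaf ([minimal_edges]).  So a component with a circuit
    is 2-regular, hence itself a circuit, and the others are trees, which belong
    to the class by minimality.  A circuit is minimal only if the path left by
    deleting an edge violates the condition, which makes its length 2i + 1 with
    i < r/(k - r) ([path_expanding]).

    Spectral half: suppose that some S violates the condition.  An isolated
    vertex of G - S has all its neighbours in S, so |S| >= d, the minimum degree.
    If |S| = d then G is a spanning subgraph of the extremal graph, and adding
    edges to a connected graph strictly increases the spectral radius
    ([q_radius_lt_supergraph], from a positive Perron vector).  If |S| > d then G
    has so many vertices with neighbours in S only that it has few edges, and
    q(G) <= 2|E|/(n-1) + n - 2 ([q_radius_le_size]) is too small: the extremal
    graph contains a complete graph of order n' = n - floor(kd/r) - 1 and has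
    spectral radius above 2(n' - 1) ([q_radius_gt_clique]).  The lower bounds on
    n serve to compare these two numbers ([size_bound]). *)

Set Implicit Arguments.
Unset Strict Implicit.
Unset Printing Implicit Defensive.

Import Order.TTheory GRing.Theory Num.Theory.

(** * Flows on the double cover *)

Section Expansion.
Variables (T : finType) (k r : nat).

Definition neighbours (e : rel T) (X : {set T}) : {set T} :=
  [set v | [exists u in X, e u v]].

(** With [X] the set of isolated vertices of a graph from which [S] has been
    removed, [neighbours e X] is contained in [S]; this form of the bound on
    isolated vertices is a Hall condition on the bipartite double cover of the
    graph, whose two sides are copies of [T]. *)
Definition expanding (e : rel T) : Prop :=
  forall X : {set T}, r * #|X| <= k * #|neighbours e X|.

Lemma neighboursP (e : rel T) (X : {set T}) v :
  reflect (exists2 u, u \in X & e u v) (v \in neighbours e X).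
Proof. by rewrite inE; apply: (iffP exists_inP). Qed.

Definition out_flow (y : T -> T -> nat) u := \sum_v y u v.
Definition in_flow (y : T -> T -> nat) v := \sum_u y u v.

(** A flow sends [y u v] units from the left copy of [u] to the right copy of
    [v].  One unit leaving [b] for some [v] can be replaced by a unit leaving
    [a], which moves the excess of [b] to [a]. *)
Definition pushable (e : rel T) (y : T -> T -> nat) : rel T :=
  fun a b => [exists v, e a v && (0 < y b v)].

(** The last clause keeps the rest of an augmenting path usable: only units
    leaving [b] disappear, and a simple path never returns to [b]. *)
Lemma augment_step (e : rel T) (y : T -> T -> nat) a b v :
  (forall p q, 0 < y p q -> e p q) -> e a v -> 0 < y b v -> a != b ->
  exists z : T -> T -> nat,
    [/\ forall p q, 0 < z p q -> e p q,
        forall p, out_flow z p + (p == b) = out_flow y p + (p == a),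
        in_flow z =1 in_flow y &
        forall p q, p != b -> y p q <= z p q].
Proof.
move=> ye eav ybv ab.
pose z p q := y p q + ((p == a) && (q == v)) - ((p == b) && (q == v)).
have zE p q : z p q + ((p == b) && (q == v)) = y p q + ((p == a) && (q == v)).
  rewrite /z subnK //; case: eqP => [->|_] //=; case: eqP => [->|_] //=.
  by lia.
have sumE (p w : T) : \sum_q nat_of_bool ((p == w) && (q == v)) = (p == w).
  rewrite (bigD1 v) //= eqxx andbT big1 ?addn0 // => q /negPf ->.
  by rewrite andbF.
exists z; split.
- move=> p q; rewrite /z.
  have [/andP[/eqP -> /eqP ->] _ //|_] := boolP ((p == a) && (q == v)).
  by rewrite addn0 => h; apply: ye; lia.
- move=> p; rewrite -(sumE p b) -(sumE p a) /out_flow -!big_split /=.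
  by apply: eq_bigr => q _; exact: zE.
- move=> q; rewrite /in_flow; apply/eqP.
  have sumE' (w : T) : \sum_p nat_of_bool ((p == w) && (q == v)) = (q == v).
    rewrite (bigD1 w) //= eqxx /= big1 ?addn0 // => p /negPf -> //.
  rewrite -(eqn_add2r (q == v)) -{1}(sumE' b) -(sumE' a) -!big_split /=.
  by apply/eqP/eq_bigr => p _; exact: zE.
- by move=> p q /negPf pb; rewrite /z pb /= subn0 leq_addr.
Qed.

Lemma sub_path_in (e1 e2 : rel T) p : forall a,
  (forall u v, v \in p -> e1 u v -> e2 u v) -> path e1 a p -> path e2 a p.
Proof.
elim: p => //= b p IH a sub /andP[eab pth]; apply/andP; split.
  by apply: sub eab; rewrite mem_head.
by apply: IH pth => u v vp; apply: sub; rewrite in_cons vp orbT.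
Qed.

Lemma augment_path (e : rel T) p : forall (y : T -> T -> nat) a,
  (forall u v, 0 < y u v -> e u v) -> path (pushable e y) a p -> uniq (a :: p) ->
  exists z : T -> T -> nat,
    [/\ forall u v, 0 < z u v -> e u v,
        forall u, out_flow z u + (u == last a p) = out_flow y u + (u == a) &
        in_flow z =1 in_flow y].
Proof.
elim: p => [|b p IH] y a ye; first by exists y.
rewrite [path _ _ _]/= [uniq _]/= => /andP[/existsP[v /andP[eav ybv]] pth] /andP[abp ubp].
have ab : a != b by apply: contraNneq abp => ->; rewrite mem_head.
have [z [ze zo zi zy]] := augment_step ye eav ybv ab.
have pthz : path (pushable e z) b p.
  apply: sub_path_in pth => u w wp /existsP[x /andP[eux ywx]].
  apply/existsP; exists x; rewrite eux; apply: leq_trans ywx (zy _ _ _).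
  by apply: contraTneq wp => ->; case/andP: ubp.
have [x [xe xo xi]] := IH z b ze pthz ubp.
exists x; split=> // [u|u]; last by rewrite xi zi.
by rewrite /=; move: (xo u) (zo u); clear; lia.
Qed.

Definition deficiency (y : T -> T -> nat) :=
  \sum_u (r - out_flow y u) + \sum_v (r - in_flow y v).

Definition bounded_flow (e : rel T) (y : T -> T -> nat) :=
  [/\ forall u v, 0 < y u v -> e u v,
      forall u, out_flow y u <= k & forall v, in_flow y v <= k].

(** Let [X] be the set of vertices to which the deficit of [a] can be pushed.
    Pushing it to a vertex with out-flow above [r], or to one with a
    neighbour of in-flow below [k], improves the flow.  If neither
    exists then every neighbour of [X] is saturated, and by vertices of [X]
    only, so [k * #|neighbours e X|] is at most the out-flow of [X], which is
    less than [r * #|X|] because of [a]. *)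
Lemma deficient_out (e : rel T) y a : r < k -> expanding e ->
  bounded_flow e y -> out_flow y a < r ->
  exists2 z, bounded_flow e z & deficiency z < deficiency y.
Proof.
move=> rk he [ye yo yi] ar.
pose X := [set x | connect (pushable e y) a x].
have aX : a \in X by rewrite inE.
have lt_def (z : T -> T -> nat) : (forall u, out_flow z u <= k) ->
    (forall u, r - out_flow z u <= r - out_flow y u) -> out_flow y a < out_flow z a ->
    (forall v, r - in_flow z v <= r - in_flow y v) -> deficiency z < deficiency y.
  move=> zk zu za zv; rewrite /deficiency -addSn leq_add //; last exact: leq_sum.
  rewrite (bigD1 a) //= [X in _ < X](bigD1 a) //= -addSn leq_add ?leq_sum //.
  lia.
have [/existsP[x /andP[xX xr]]|/existsPn nox] :=
    boolP [exists x, (x \in X) && (r < out_flow y x)].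
  (* the surplus of x pays for the deficit of a *)
  move: xX; rewrite inE => /connectP[p pth xE].
  case/shortenP: pth xE => p' pth up _ xE.
  have [z [ze zo zi]] := augment_path ye pth up.
  rewrite -xE in zo.
  have ax : (a == x) = false by apply/negP => /eqP ax; move: xr ar; rewrite ax; lia.
  have zk u : out_flow z u <= k.
    by move: (zo u) (yo u); have [->|_] := eqVneq u a; rewrite ?ax; lia.
  exists z; first by split=> // v; rewrite zi.
  apply: lt_def => // [u||v]; last by rewrite zi.
    move: (zo u); have [->|_] := eqVneq u x; rewrite ?[x == a]eq_sym ?ax; lia.
  by move: (zo a); rewrite eqxx ax; lia.
have [/existsP[x /existsP[v /and3P[xX exv vk]]]|/existsPn nov] :=
    boolP [exists x, exists v, [&& x \in X, e x v & in_flow y v < k]].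
  move: xX; rewrite inE => /connectP[p pth xE].
  case/shortenP: pth xE => p' pth up _ xE.
  have [z [ze zo zi]] := augment_path ye pth up.
  rewrite -xE in zo.
  (* push the deficit to x, then send one more unit from x to v *)
  pose w p q := z p q + ((p == x) && (q == v)).
  have wo u : out_flow w u = out_flow y u + (u == a).
    rewrite -zo /out_flow /w big_split /=; congr (_ + _).
    by rewrite (bigD1 v) //= eqxx andbT big1 ?addn0 // => q /negPf ->; rewrite andbF.
  have wi u : in_flow w u = in_flow y u + (u == v).
    rewrite -zi /in_flow /w big_split /=; congr (_ + _).
    by rewrite (bigD1 x) //= eqxx /= big1 ?addn0 // => q /negPf ->.
  have wk u : out_flow w u <= k.
    by rewrite wo; move: (yo u); have [->|_] := eqVneq u a; lia.
  exists w.
    split=> // [p0 q|q]; last first.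
      by rewrite wi; move: (yi q); have [->|_] := eqVneq q v; lia.
    rewrite /w; have [/andP[/eqP -> /eqP ->] //|_] := boolP ((p0 == x) && (q == v)).
    by rewrite addn0; apply: ze.
  by apply: lt_def => // [u||u]; rewrite ?wo ?wi ?eqxx; lia.
have full v : v \in neighbours e X -> in_flow y v = k.
  case/neighboursP => x xX exv; apply/eqP; rewrite eqn_leq yi /= leqNgt.
  by apply/negP => vk; move/existsPn/(_ v): (nov x); rewrite xX exv vk.
have inX v : v \in neighbours e X -> forall x, 0 < y x v -> x \in X.
  case/neighboursP => w wX ewv x yxv; move: wX; rewrite !inE => aw.
  by apply: connect_trans aw (connect1 _); apply/existsP; exists v; rewrite ewv.
have : k * #|neighbours e X| <= \sum_(x in X) out_flow y x.
  rewrite mulnC -sum_nat_const.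
  under eq_bigr => v vN do rewrite -(full v vN).
  apply: (@leq_trans (\sum_(v in neighbours e X) \sum_(x in X) y x v)).
    apply: leq_sum => v vN; rewrite /in_flow (bigID [in X]) /= addnC big1 // => x xX.
    by apply/eqP; rewrite -leqn0 leqNgt; apply: contra xX; apply: inX.
  rewrite exchange_big /=; apply: leq_sum => x _.
  by rewrite /out_flow [X in _ <= X](bigID [in neighbours e X]) /= leq_addr.
suff : \sum_(x in X) out_flow y x < r * #|X| by move: (he X); lia.
rewrite mulnC -sum_nat_const (bigD1 a) //= [X in _ < X](bigD1 a) //= -addSn leq_add //.
by apply: leq_sum => x /andP[xX _]; move: (nox x); rewrite xX /= -leqNgt.
Qed.

(** Transposing a flow exchanges out-flow and in-flow, so both kinds of
    deficiency are repaired by [deficient_out]. *)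
Lemma flow_exists (e : rel T) : r < k -> symmetric e -> expanding e ->
  exists2 y, bounded_flow e y &
    (forall u, r <= out_flow y u) /\ (forall v, r <= in_flow y v).
Proof.
move=> rk esym he.
suff H n : forall y, bounded_flow e y -> deficiency y <= n ->
    exists2 z, bounded_flow e z & deficiency z = 0.
  have b0 : bounded_flow e (fun _ _ => 0).
    by split=> // u; rewrite /out_flow /in_flow big1.
  have [z bz /eqP] := H _ _ b0 (leqnn _).
  rewrite addn_eq0 !sum_nat_eq0 => /andP[/forallP zo /forallP zi].
  by exists z.
elim: n => [|n IH] y by_ dy; first by exists y => //; apply/eqP; rewrite -leqn0.
have [d0|dn] := posnP (deficiency y); first by exists y.
suff [z bz dz] : exists2 z, bounded_flow e z & deficiency z < deficiency y.
  by apply: (IH z bz); rewrite -ltnS; apply: leq_trans dz dy.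
have [/existsP[a ao]|/existsPn noo] := boolP [exists a, out_flow y a < r].
  exact: deficient_out by_ ao.
have [/existsP[a ai]|/existsPn noi] := boolP [exists a, in_flow y a < r].
  have bt : bounded_flow e (fun u v => y v u).
    by case: by_ => ye yo yi; split=> // u v /ye; rewrite esym.
  have [z [ze zo zi] dz] := deficient_out rk he bt ai.
  exists (fun u v => z v u); first by split=> // u v /ze; rewrite esym.
  by move: dz; rewrite /deficiency addnC [X in _ < X]addnC.
move: dn; rewrite /deficiency !big1 // => u _; apply/eqP; rewrite subn_eq0 leqNgt //.
Qed.
End Expansion.

(** * Edges and degrees *)

Lemma edge_set2 (G : sgraph) (u v : G) : ([set u; v] \in edges G) = adj u v.
Proof.
rewrite inE; apply/existsP/idP => [[p /existsP[q /andP[pq /eqP/setP eq]]]|uv].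
  have := eq u; have := eq v; have := eq p; have := eq q.
  rewrite !inE !eqxx !orbT !orTb.
  move=> /orP[]/eqP qE /orP[]/eqP pE; move: pq; rewrite qE pE ?adj_irrefl //.
    by rewrite adj_sym.
by exists u; apply/existsP; exists v; rewrite uv eqxx.
Qed.

Lemma edgesP (G : sgraph) (e : {set G}) :
  reflect (exists u v, adj u v /\ e = [set u; v]) (e \in edges G).
Proof.
apply: (iffP idP) => [|[u [v [uv ->]]]]; last by rewrite edge_set2.
by rewrite inE => /existsP[u /existsP[v /andP[uv /eqP ->]]]; exists u, v.
Qed.

Lemma sum_degrees (G : sgraph) : \sum_(u : G) degree u = 2 * #|edges G|.
Proof.
have degE (u : G) : degree u = \sum_(e in edges G) (u \in e).
  rewrite -big_mkcondr /= sum1dep_card /degree.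
  have inj : {in [set y | adj u y] &, injective (fun y => [set u; y])}.
    move=> x y; rewrite !inE => ux uy /setP/(_ x); rewrite !inE eqxx orbT.
    by case/esym/orP => /eqP // xu; move: ux; rewrite xu adj_irrefl.
  rewrite -(card_in_imset inj); apply: eq_card => e; rewrite !inE.
  apply/imsetP/andP => [[y]|[/existsP[x /existsP[y /andP[xy /eqP ->]]]]].
    by rewrite inE => uy ->; rewrite -edge_set2 inE in uy; rewrite uy !inE eqxx.
  rewrite !inE => /orP[]/eqP ->; first by exists y; rewrite ?inE.
  by exists x; rewrite ?inE 1?adj_sym // setUC.
under eq_bigr => u _ do rewrite degE.
rewrite exchange_big /= mulnC -sum_nat_const; apply: eq_bigr => _ /edgesP[u [v [uv ->]]].
have uv' : u != v by apply: contraTneq uv => ->; rewrite adj_irrefl.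
rewrite -[RHS](_ : #|[set u; v]| = 2); last by rewrite cards2 uv'.
by rewrite -sum1_card [RHS]big_mkcond; apply: eq_bigr => x _; case: (x \in _).
Qed.

(** * Fractional factors and minimal graphs *)

Section Circulations.
Local Open Scope ring_scope.

Section Fractional.
Variables (T : finType) (k r : nat).

Definition fractional_factor (e : rel T) (w : T -> T -> rat) : Prop :=
  [/\ forall u v, w u v = w v u, forall u v, 0 <= w u v,
      forall u v, 0 < w u v -> e u v &
      forall u, r%:R <= \sum_v w u v <= k%:R].

(** Minimality refers to symmetric subrelations rather than to sets of edges, so
    that it passes to components and along isomorphisms. *)
Definition minimally_expanding (e : rel T) : Prop :=
  expanding k r e /\
  forall e' : rel T, symmetric e' -> subrel e' e -> expanding k r e' -> subrel e e'.

(** Count the weight that leaves [X]: it is at least [r * #|X|], and all of it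
    arrives in the neighbourhood, which receives at most [k] per vertex. *)
Lemma factor_expanding (e : rel T) w : fractional_factor e w -> expanding k r e.
Proof.
case=> ws w0 we wd X; rewrite -(ler_nat rat) !natrM.
have -> : r%:R * #|X|%:R = \sum_(u in X) r%:R :> rat by rewrite sumr_const mulr_natr.
have -> : k%:R * #|neighbours e X|%:R = \sum_(v in neighbours e X) k%:R :> rat.
  by rewrite sumr_const mulr_natr.
apply: (@le_trans _ _ (\sum_(u in X) \sum_(v in neighbours e X) w u v)).
  apply: ler_sum => u uX; have /andP[ru _] := wd u.
  apply: le_trans ru _; rewrite (bigID [in neighbours e X]) /= -[leRHS]addr0 lerD2l.
  rewrite big1 // => v vN; apply/eqP; rewrite eq_le w0 andbT leNgt.
  by apply: contra vN => /we euv; apply/neighboursP; exists u.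
rewrite exchange_big /=; apply: ler_sum => v _; have /andP[_ vk] := wd v.
apply: le_trans vk; rewrite [leRHS](bigID [in X]) /=.
under eq_bigr => u _ do rewrite ws.
by rewrite lerDl; apply: sumr_ge0.
Qed.

(** Average a flow on the double cover with its transpose. *)
Lemma factor_exists (e : rel T) : (r < k)%N -> symmetric e -> expanding k r e ->
  exists w, fractional_factor e w.
Proof.
move=> rk es he; have [y [ye yo yi] [yro yri]] := flow_exists rk es he.
exists (fun u v => ((y u v + y v u)%:R / 2%:R)); split.
- by move=> u v; rewrite addnC.
- by move=> u v; rewrite divr_ge0 ?ler0n.
- move=> u v; have [euv|/negP neuv] := boolP (e u v) => //.
  have -> : y u v = 0%N by apply/eqP; rewrite -leqn0 leqNgt; apply/negP => /ye.
  have -> : y v u = 0%N.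
    by apply/eqP; rewrite -leqn0 leqNgt; apply/negP => /ye; rewrite es.
  by rewrite mul0r ltxx.
move=> u; rewrite -mulr_suml -natr_sum big_split /= natrD.
move: (yo u) (yi u) (yro u) (yri u).
rewrite /out_flow /in_flow -!(ler_nat rat); lra.
Qed.

(** If [z] were negative somewhere, move a fractional factor [w] along [z] until
    its first edge vanishes.  Vertex sums do not change, except that the sum
    may grow at a vertex [u] all of whose weight goes to a single neighbour
    [p]; that weight stays below [k] because the sum at [p] is unchanged.
    The support of the result is a proper subgraph that is still expanding,
    against minimality. *)
Lemma no_negative_circulation (e : rel T) (z : T -> T -> rat) :
  (r < k)%N -> symmetric e -> minimally_expanding e ->
  (forall u v, z u v = z v u) -> (forall u v, z u v != 0 -> e u v) ->
  (forall u, \sum_v z u v = 0 \/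
     0 <= \sum_v z u v /\
     exists p, (forall v, e u v -> v = p) /\ \sum_v z p v = 0) ->
  forall u v, 0 <= z u v.
Proof.
move=> rk es [he emin] zs ze zb.
suff H : [forall p : T * T, 0 <= z p.1 p.2] by move=> u v; move/forallP/(_ (u, v)): H.
apply: contraT => /forallPn[p0]; rewrite -ltNge => p0n.
have [w [ws w0 we wd]] := factor_exists rk es he.
case: (@Order.TotalTheory.arg_minP _ _ _ p0 (fun p => z p.1 p.2 < 0)
         (fun p => w p.1 p.2 / - z p.1 p.2) p0n) => -[a b] /= zab abmin.
set eps := w a b / - z a b in abmin.
have eps0 : 0 <= eps by rewrite divr_ge0 // oppr_ge0 ltW.
pose w' u v := w u v + eps * z u v.
have w's u v : w' u v = w' v u by rewrite /w' ws zs.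
have w'0 u v : 0 <= w' u v.
  have [zuv|zuv] := leP 0 (z u v); first by apply: addr_ge0; [exact: w0|exact: mulr_ge0].
  have := abmin (u, v) zuv; rewrite /= ler_pdivlMr ?oppr_gt0 // /w' mulrN; lra.
have w'ab : w' a b = 0.
  by rewrite /w' /eps invrN mulrN mulNr divfK ?subrr // lt_eqF.
have w'e u v : 0 < w' u v -> e u v.
  have [z0|/ze //] := eqVneq (z u v) 0.
  by rewrite /w' z0 mulr0 addr0; apply: we.
have sumE u : \sum_v w' u v = \sum_v w u v + eps * \sum_v z u v.
  by rewrite big_split /= mulr_sumr.
have fw : fractional_factor (fun u v => 0 < w' u v) w'.
  split=> // u; have /andP[lo up] := wd u.
  case: (zb u) => [z0|[z0 [p [up1 zp]]]]; first by rewrite sumE z0 mulr0 addr0 wd.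
  apply/andP; split; first by rewrite sumE (le_trans lo) // lerDl mulr_ge0.
  have /andP[_] := wd p; apply: le_trans.
  rewrite (bigD1 p) //= big1 ?addr0; last first.
    move=> v vp; apply/eqP; rewrite eq_le w'0 andbT leNgt.
    by apply: contra vp => /w'e /up1 ->.
  have -> : \sum_v w p v = \sum_v w' p v by rewrite sumE zp mulr0 addr0.
  by rewrite w's (bigD1 u) //= lerDl sumr_ge0.
have sub := emin (fun u v => 0 < w' u v) _ _ (factor_expanding fw).
have eab : e a b by apply: ze; rewrite lt_eqF.
have : 0 < w' a b by apply: sub => // u v; rewrite w's.
by rewrite w'ab ltxx.
Qed.
End Fractional.

Lemma underdetermined (F : fieldType) (A B : finType) (D : {set A}) (C : {set B})
    (a : A -> B -> F) : (#|C| < #|D|)%N ->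
  exists2 z : A -> F, exists2 x, x \in D & z x != 0 &
     forall b, b \in C -> \sum_x z x * a x b = 0.
Proof.
move=> CD.
pose M := \matrix_(i < #|D|, j < #|C|) a (enum_val i) (enum_val j).
have /rowV0Pn[v /sub_kermxP vM v0] : kermx M != 0.
  rewrite -mxrank_eq0 mxrank_ker subn_eq0 -ltnNge.
  by apply: leq_ltn_trans CD; apply: rank_leq_col.
pose z x := \sum_i (x == enum_val i :> A)%:R * v 0 i.
have zE i : z (enum_val i) = v 0 i.
  rewrite /z (bigD1 i) //= eqxx mul1r big1 ?addr0 // => j ji.
  by rewrite (inj_eq enum_val_inj) eq_sym (negPf ji) mul0r.
exists z.
  have [i vi] : exists i, v 0 i != 0.
    apply/existsP; apply: contraNT v0 => /existsPn v0; apply/eqP/rowP => i.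
    by rewrite mxE; apply/eqP; move: (v0 i); rewrite negbK.
  by exists (enum_val i); rewrite ?zE // enum_valP.
move=> b bC; move/rowP/(_ (enum_rank_in bC b)): vM; rewrite !mxE.
under eq_bigr => i _ do rewrite mxE enum_rankK_in // -zE.
move=> vM.
rewrite (bigID [in D]) /= [X in _ + X]big1 ?addr0; last first.
  move=> x xD; rewrite /z big1 ?mul0r // => i _.
  by case: eqP => [xi|]; rewrite ?mul0r //; move: xD; rewrite xi enum_valP.
by rewrite big_enum_val.
Qed.

(** Label the edges by unknowns and ask that the sum at every vertex outside
    [L] be zero.  With more edges than such vertices there is a nonzero
    solution, and up to sign its sum at the leaf in [L] is nonnegative.  Then
    all its values are nonnegative by [no_negative_circulation]; but an edge
    with nonzero value has an end outside [L], where the sum is zero. *)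
Lemma minimal_edges (G : sgraph) (k r : nat) (L : {set G}) :
  (r < k)%N -> minimally_expanding k r (@adj G) -> (#|L| <= 1)%N ->
  (forall l, l \in L -> exists2 p, adj l p & forall v, adj l v -> v = p) ->
  (#|edges G| <= #|~: L|)%N.
Proof.
move=> rk mG L1 leaf; rewrite leqNgt; apply/negP => lt.
pose a (e : {set G}) (u : G) : rat := \sum_v (adj u v && (e == [set u; v]))%:R.
have [x [e0 e0E x0] xs] := underdetermined a lt.
pose c u := \sum_(v | adj u v) x [set u; v].
have cE u : c u = \sum_e x e * a e u.
  rewrite /c /a; under [RHS]eq_bigr => e _ do rewrite mulr_sumr.
  rewrite exchange_big big_mkcond /=; apply: eq_bigr => v _.
  rewrite (bigD1 [set u; v]) //= eqxx andbT big1 ?addr0.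
    by case: ifP; rewrite ?mulr1 ?mulr0.
  by move=> e /negPf ->; rewrite andbF mulr0.
have c0 u : u \notin L -> \sum_(v | adj u v) x [set u; v] = 0.
  by move=> uL; rewrite -/(c u) cE xs // inE.
wlog sg : x e0 e0E x0 {xs c cE} c0 /
    forall l, l \in L -> 0 <= \sum_(v | adj l v) x [set l; v].
  move=> IH.
  have [/forall_inP|/forall_inPn[l lL]] :=
    boolP [forall l in L, 0 <= \sum_(v | adj l v) x [set l; v]].
    exact: (IH x e0).
  rewrite -ltNge => cl; apply: (IH (fun e => - x e) e0) => //.
  - by rewrite oppr_eq0.
  - by move=> u /c0; rewrite sumrN => ->; rewrite oppr0.
  move=> l' l'L; have -> : l' = l.
    by move/card_le1_eqP: L1; apply.
  by rewrite sumrN oppr_ge0 ltW.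
pose c u := \sum_(v | adj u v) x [set u; v].
pose z u v := if adj u v then x [set u; v] else 0.
have zc u : \sum_v z u v = c u by rewrite /c [RHS]big_mkcond.
have zpos : forall u v, 0 <= z u v.
  apply: (no_negative_circulation rk (@adj_sym G) mG).
  - by move=> u v; rewrite /z adj_sym setUC.
  - by move=> u v; rewrite /z; case: ifP; rewrite ?eqxx.
  move=> u; rewrite zc; have [uL|/c0] := boolP (u \in L); last by left.
  right; split; first exact: sg.
  have [p up pu] := leaf u uL; exists p; split=> //; rewrite zc; apply: c0.
  apply/negP => pL; have pu' : p = u by move/card_le1_eqP: L1; apply.
  by move: up; rewrite pu' adj_irrefl.
move: e0E x0; rewrite inE => /existsP[u /existsP[v /andP[uv /eqP ->]]].
wlog uL : u v uv / u \notin L.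
  move=> h; have [uL|] := boolP (u \in L); last exact: h.
  rewrite setUC; apply: (h v u); first by rewrite adj_sym.
  apply/negP => vL; have vu' : v = u by move/card_le1_eqP: L1; apply.
  by move: uv; rewrite vu' adj_irrefl.
have := zc u; rewrite [c u]c0 // => /eqP; rewrite psumr_eq0 // => /allP/(_ v).
by rewrite mem_index_enum /z uv /= => /(_ isT) ->.
Qed.
End Circulations.

(** * Isolated vertices *)

Section Isolated.
Variable G : sgraph.

Definition isolated_outside (S : {set G}) : {set G} :=
  [set x in ~: S | [forall y, adj x y ==> (y \in S)]].

Lemma num_isolatedE (S : {set G}) :
  num_isolated (remove_vertices S) = #|isolated_outside S|.
Proof.
rewrite /num_isolated -(card_imset _ val_inj); apply: eq_card => x.
rewrite !inE; apply/imsetP/andP => [[[y yS]]|[xS /forallP xn]].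
  rewrite inE cards_eq0 => /eqP/setP y0 ->; rewrite /= -in_setC; split=> //.
  apply/forallP => z; apply/implyP => yz; apply: contraT; rewrite -in_setC => zS.
  by have := y0 (exist _ z zS); rewrite !inE /= /induced_adj /= yz.
rewrite -in_setC in xS; exists (exist _ x xS) => //; rewrite inE cards_eq0.
apply/eqP/setP => -[y yS]; rewrite !inE /= /induced_adj /=.
by apply/negP => xy; have := implyP (xn y) xy; move: yS; rewrite inE => /negPf ->.
Qed.

Lemma isolated_boundE k r (S : {set G}) : 0 < r ->
  isolated_bound k r S = (r * #|isolated_outside S| <= k * #|S|).
Proof.
move=> r0; rewrite /isolated_bound num_isolatedE mulrAC ler_pdivlMr ?ltr0n //.
by rewrite -!natrM ler_nat mulnC.
Qed.

(** For an arbitrary [X] apply the bound to the neighbourhood of the set [I] of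
    isolated vertices of the graph induced on [X].  The vertices of [X] outside
    [I] are themselves neighbours of [X], and not neighbours of [I], so each
    of them pays for itself. *)
Lemma isolated_expanding k r : 0 < r -> r <= k ->
  (forall S : {set G}, isolated_bound k r S) <-> expanding k r (@adj G).
Proof.
move=> r0 rk; split=> [iso X|he S]; last first.
  rewrite isolated_boundE //; apply: leq_trans (he _) _.
  rewrite leq_mul2l subset_leq_card ?orbT //; apply/subsetP => y.
  by case/neighboursP => x; rewrite inE => /andP[_ /forallP/(_ y)/implyP]; apply.
pose I := [set x in X | [forall y in X, ~~ adj x y]].
have /subset_leq_card leI : I \subset isolated_outside (neighbours (@adj G) I).
  apply/subsetP => x xI; rewrite !inE; apply/andP; split.
    apply/negP => /exists_inP[y]; rewrite inE => /andP[_ /forall_inP/(_ x)].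
    by move: xI; rewrite inE => /andP[xX _] /(_ xX) /negPf ->.
  apply/forallP => y; apply/implyP => xy; rewrite inE; apply/exists_inP.
  by exists x.
have subN : (X :\: I) :|: neighbours (@adj G) I \subset neighbours (@adj G) X.
  apply/subsetP => x; rewrite in_setU => /orP[|/neighboursP[y]].
    rewrite inE inE andbC => /andP[xX]; rewrite xX /= => /forall_inPn[y yX].
    by rewrite negbK => xy; apply/neighboursP; exists y; rewrite // adj_sym.
  by rewrite inE => /andP[yX _] yx; apply/neighboursP; exists y.
have dis : (X :\: I) :&: neighbours (@adj G) I = set0.
  apply/setP => x; rewrite in_setI in_set0; apply/negP => /andP[/setDP[xX _]].
  case/neighboursP => y; rewrite inE => /andP[_ /forall_inP/(_ x xX)].
  by move=> /negPf ->.
have := subset_leq_card subN; rewrite cardsU dis cards0 subn0.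
have IX : I \subset X by apply/subsetP => x; rewrite inE => /andP[].
rewrite cardsD (setIidPr IX); have := subset_leq_card IX.
move: (iso (neighbours (@adj G) I)); rewrite isolated_boundE //.
by nia.
Qed.
End Isolated.

(** * Paths and cycles *)

Definition path_adj m : rel 'I_m :=
  fun i j => (j == i.+1 :> nat) || (i == j.+1 :> nat).

(** The neighbourhood [N] of [X] contains the shift of [X] up, which loses only
    the last vertex of the path, and the shift down, which loses only the
    first.  Hence [#|N| < #|X|] forces both ends into [X] and
    both shifts to be all of [N]; then [X] contains all even vertices and [N]
    all odd ones, the last vertex is some [2 * i], [#|X| = #|N| + 1] and
    [i <= #|N|]. *)
Lemma path_expanding m k r : r < k ->
  (forall i, m.+1 = 2 * i + 1 -> r <= (k - r) * i) -> expanding k r (@path_adj m.+1).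
Proof.
move=> rk hm X; set N := neighbours _ X.
have up : @ordS m.+1 @: (X :\ ord_max) \subset N.
  apply/subsetP => _ /imsetP[x /setD1P[xm xX] ->]; apply/neighboursP; exists x => //.
  have xlt : x < m by rewrite ltn_neqAle -ltnS ltn_ord andbT; exact: xm.
  by rewrite /path_adj /= modn_small ?eqxx.
have down : @ord_pred m.+1 @: (X :\ ord0) \subset N.
  apply/subsetP => _ /imsetP[x /setD1P[x0 xX] ->]; apply/neighboursP; exists x => //.
  have xgt : 0 < x by rewrite lt0n; exact: x0.
  rewrite /path_adj /=; apply/orP; right.
  have -> : (x + m.+1).-1 = x.-1 + m.+1 by lia.
  by rewrite modnDr modn_small; have := ltn_ord x; lia.
have cup := subset_leq_card up; have cdn := subset_leq_card down.
rewrite card_imset in cup; last exact: ordS_inj.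
rewrite card_imset in cdn; last exact: ord_pred_inj.
have cX := cardsD1 ord_max X; have cX0 := cardsD1 ord0 X.
have [XN|NX] := leqP #|X| #|N|; first by apply: leq_mul => //; exact: ltnW.
have mX : ord_max \in X by apply/negPn/negP => /negPf h; move: cX; rewrite h; lia.
have oX : ord0 \in X by apply/negPn/negP => /negPf h; move: cX0; rewrite h; lia.
have cN : #|X| = #|N|.+1 by move: cX; rewrite mX; lia.
have upE : @ordS m.+1 @: (X :\ ord_max) = N.
  by apply/eqP; rewrite eqEcard up card_imset; [move: cX; rewrite mX; lia|exact: ordS_inj].
have dnE : @ord_pred m.+1 @: (X :\ ord0) = N.
  by apply/eqP; rewrite eqEcard down card_imset; [move: cX0; rewrite oX; lia|exact: ord_pred_inj].
have even j (lt : 2 * j < m.+1) : Ordinal lt \in X.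
  elim: j lt => [|j IH] lt; first by rewrite (_ : Ordinal lt = ord0) //; apply: val_inj.
  have lt' : 2 * j < m.+1 by lia.
  have : ordS (Ordinal lt') \in N.
    rewrite -upE; apply: imset_f; rewrite !inE IH andbT -val_eqE /=; lia.
  rewrite -dnE => /imsetP[y /setD1P[y0 yX]] /(congr1 val) /=.
  have ygt : 0 < y by rewrite lt0n; exact: y0.
  have -> : (y + m.+1).-1 = y.-1 + m.+1 by lia.
  rewrite modnDr !modn_small; [|have := ltn_ord y; lia|lia].
  by move=> yE; rewrite (_ : Ordinal lt = y) //; apply: val_inj => /=; lia.
have odd_in j (lt : 2 * j + 1 < m.+1) : Ordinal lt \in N.
  have lt' : 2 * j < m.+1 by lia.
  rewrite (_ : Ordinal lt = ordS (Ordinal lt')); last first.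
    by apply: val_inj; rewrite /= modn_small; lia.
  by rewrite -upE; apply: imset_f; rewrite !inE even andbT -val_eqE /=; lia.
have modd : ~~ odd m.
  apply/negP => om; have lt : 2 * m./2 + 1 < m.+1.
    by have := odd_double_half m; rewrite om; lia.
  have := odd_in _ lt; rewrite -dnE => /imsetP[y /setD1P[y0 yX]] /(congr1 val) /=.
  have ygt : 0 < y by rewrite lt0n; exact: y0.
  have -> : (y + m.+1).-1 = y.-1 + m.+1 by lia.
  rewrite modnDr modn_small; last by have := ltn_ord y; lia.
  by have := ltn_ord y; have := odd_double_half m; rewrite om; lia.
have mE : m.+1 = 2 * m./2 + 1.
  by have := odd_double_half m; rewrite (negPf modd); lia.
have leN : m./2 <= #|N|.
  have lt (j : 'I_(m./2)) : 2 * j + 1 < m.+1 by have := ltn_ord j; lia.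
  rewrite -[m./2]card_ord -(card_imset (f := fun j => Ordinal (lt j))).
    by apply/subset_leq_card/subsetP => _ /imsetP[j _ ->]; exact: odd_in.
  by move=> i j /(congr1 val) /= ij; apply: val_inj; rewrite /=; lia.
have := hm _ mE; rewrite cN; nia.
Qed.

(** The path obtained by deleting the edge between the last vertex and vertex 0
    is not expanding. *)
Lemma minimal_cycle m k r : r < k -> 2 < m ->
  minimally_expanding k r (@cycle_adj m) ->
  exists i, [/\ m = 2 * i + 1, 0 < i & (k - r) * i < r].
Proof.
case: m => // m rk m2 [_ hmin].
have [/existsP[i /andP[/eqP mi ri]]|/existsPn no] :=
  boolP [exists i : 'I_m.+1, (m.+1 == 2 * i + 1) && ((k - r) * i < r)].
  by exists i; split=> //; lia.
have hp : expanding k r (@path_adj m.+1).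
  apply: path_expanding => // i mi; have lti : i < m.+1 by lia.
  by move: (no (Ordinal lti)); rewrite /= -mi eqxx /= -leqNgt.
have psym : symmetric (@path_adj m.+1) by move=> i j; rewrite /path_adj orbC.
have psub : subrel (@path_adj m.+1) (@cycle_adj m.+1).
  move=> i j; rewrite /path_adj /cycle_adj -!val_eqE /=.
  have := ltn_ord i; have := ltn_ord j.
  move=> jm im /orP[]/eqP h.
    by rewrite (@modn_small i.+1) -h // eqxx andbT h; lia.
  by rewrite (@modn_small j.+1) -h // eqxx orbT andbT h; lia.
have := hmin _ psym psub hp ord0 ord_max.
rewrite /cycle_adj /path_adj -!val_eqE /= modnn eqxx orbT andbT.
by move=> /(_ _)/orP; lia.
Qed.

(** * Minimal connected graphs *)

Lemma next_next (T : eqType) (c : seq T) x :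
  uniq c -> 2 < size c -> x \in c -> next c (next c x) != x.
Proof.
move=> uc sc xc; have [i s' rE] := rot_to xc.
rewrite -!(next_rot i uc) rE; move: uc sc; rewrite -(rot_uniq i) -(size_rot i) rE.
case: s' {rE} => [|y [|z s]] //=; rewrite !inE !negb_or eqxx.
move=> /and3P[/and3P[xy xz xs] /andP[yz ys] _] _.
by rewrite (eq_sym y x) (negPf xy) eqxx eq_sym.
Qed.

(** The cycle has as many edges as vertices, since [x] determines the edge from
    [x] to the next vertex injectively.  A largest vertex set that contains the
    cycle and spans at least as many edges as it has vertices is everything:
    otherwise an edge leaves it, and adding the other end of this edge
    enlarges the set. *)
Lemma card_edges_connected (G : sgraph) (c : seq G) :
  connected_graph G -> ucycle (@adj G) c -> 2 < size c -> #|G| <= #|edges G|.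
Proof.
move=> [_ conn] /andP[cyc uc] sc.
pose E (S : {set G}) := [set e in edges G | e \subset S].
have E0 : #|[set x in c]| <= #|E [set x in c]|.
  have inj : {in [set x in c] &, injective (fun x => [set x; next c x])}.
    move=> x y; rewrite !inE => xc yc /setP eq.
    have := eq x; have := eq y; rewrite !inE !eqxx /=.
    move=> /orP[/eqP -> //|/eqP yn] /esym/orP[/eqP -> //|/eqP xn].
    by have := next_next uc sc yc; rewrite -xn -yn eqxx.
  rewrite -(card_in_imset inj); apply/subset_leq_card/subsetP => _ /imsetP[x xc ->].
  rewrite inE in xc; rewrite inE edge_set2 next_cycle //=.
  by rewrite subUset !sub1set !inE xc mem_next.
pose P (S : {set G}) := ([set x in c] \subset S) && (#|S| <= #|E S|).
have [|S /maxsetP[/andP[cS leS] Smax] _] := @maxset_exists _ P [set x in c].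
  by rewrite /P subxx.
suff ST : S = setT.
  move: leS; rewrite ST cardsT => /leq_trans; apply.
  by apply: subset_leq_card; apply/subsetP => e; rewrite inE => /andP[].
apply/eqP; rewrite -subTset; apply/subsetP => z _.
apply: contraT => zS.
have [a aS] : exists a, a \in S.
  case: c {cyc uc E0 P Smax} sc cS => // a c _ /subsetP/(_ a).
  by rewrite !inE eqxx => /(_ isT); exists a.
have [/forall_inP h|/forall_inPn[x xS /forallPn[y]]] :=
    boolP [forall x in S, forall y, adj x y ==> (y \in S)].
  have cl : closed (@adj G) [in S].
    move=> x y xy; apply/idP/idP => [xS|yS].
      by have /forallP/(_ y)/implyP := h x xS; apply.
    by have /forallP/(_ x)/implyP := h y yS; apply; rewrite adj_sym.
  by have := closed_connect cl (conn a z); rewrite -!topredE /= aS (negPf zS).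
rewrite negb_imply => /andP[xy yS].
suff /(congr1 (fun A : {set G} => y \in A)) : y |: S = S.
  by rewrite setU11 (negPf yS).
apply: Smax; last exact: subsetUr.
rewrite /P (subset_trans cS) ?subsetUr //= cardsU1 yS add1n.
apply: leq_ltn_trans leS _; apply: proper_card; apply/properP; split.
  apply/subsetP => e; rewrite !inE => /andP[-> /= /subset_trans]; apply.
  exact: subsetUr.
exists [set x; y]; first by rewrite inE edge_set2 xy subUset !sub1set !inE xS eqxx orbT.
by rewrite inE subUset !sub1set (negPf yS) !andbF.
Qed.

Lemma expanding_iso (A B : finType) (f : A -> B) k r (e : rel B) :
  bijective f -> expanding k r (fun x y => e (f x) (f y)) <-> expanding k r e.
Proof.
move=> bf; have fi := bij_inj bf.
have nE (X : {set A}) : neighbours e (f @: X) = f @: neighbours (fun x y => e (f x) (f y)) X.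
  apply/setP => y; have [g fK gK] := bf; rewrite -(gK y) mem_imset //.
  apply/neighboursP/neighboursP => [[_ /imsetP[x xX ->]]|[x xX]]; rewrite gK => h.
    by exists x; rewrite // gK.
  by exists (f x); rewrite ?imset_f // -(gK y).
split=> h X; last by have := h (f @: X); rewrite nE !card_imset.
have [g fK gK] := bf; have -> : X = f @: (g @: X).
  by rewrite -imset_comp -[LHS]imset_id; apply: eq_imset => x /=; rewrite gK.
by rewrite nE !(card_imset _ fi); apply: h.
Qed.

Lemma minimal_iso (A B : finType) (f : A -> B) k r (e : rel A) (e' : rel B) :
  bijective f -> (forall x y, e' (f x) (f y) = e x y) ->
  minimally_expanding k r e -> minimally_expanding k r e'.
Proof.
move=> bf ef [he hm]; split.
  apply/(expanding_iso k r e' bf) => X; rewrite [neighbours _ _](_ : _ = neighbours e X) //.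
  by apply/setP => y; rewrite !inE; under eq_existsb => x do rewrite ef.
move=> e2 s2 sub /(expanding_iso k r e2 bf) h2 x y.
have [g fK gK] := bf; rewrite -(gK x) -(gK y) ef.
apply: (hm (fun x y => e2 (f x) (f y))) => // u v /sub.
by rewrite ef.
Qed.

Lemma hamilton_cycle_iso (G : sgraph) (c : seq G) :
  ucycle (@adj G) c -> (forall x, x \in c) ->
  (forall x y, adj x y = (y == next c x) || (x == next c y)) ->
  isomorphic G (cycle_graph #|G|).
Proof.
move=> /andP[cyc uc] call adjE.
have sc : size c = #|G| by rewrite -(card_uniqP uc); apply: eq_card => x; rewrite call.
have lt x : index x c < #|G| by rewrite -sc index_mem call.
pose f x := Ordinal (lt x).
have fi : injective f by move=> x y /(congr1 val) /= /index_inj; apply.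
have fn x : f (next c x) = ordS (f x).
  apply: val_inj; rewrite /= next_nth call -sc.
  case: c {f fi adjE cyc lt} uc call sc => [|a c] uc call sc; first by have := call x.
  have := call x; rewrite -index_mem; set j := index x _.
  rewrite [size _]/= ltnS leq_eqVlt => /orP[/eqP ix|ix].
    by rewrite ix modnn nth_default ?index_head // ix.
  by rewrite modn_small // -[nth a c j]/(nth a (a :: c) j.+1) index_uniq.
exists f.
  by apply: inj_card_bij => //; rewrite card_ord.
move=> x y; rewrite adjE /cycle_adj /= /cycle_adj (inj_eq fi) -!fn !(inj_eq fi).
have [<-|//] := eqVneq x y; rewrite orbb /=; apply/esym/negbTE/negP => /eqP xn.
by have := next_cycle cyc (call x); rewrite -xn adj_irrefl.
Qed.

Lemma expanding_degree (G : sgraph) k r (x : G) : 0 < r ->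
  expanding k r (@adj G) -> 0 < degree x.
Proof.
move=> r0 /(_ [set x]); rewrite cards1 muln1 => h.
have : 0 < #|neighbours (@adj G) [set x]|.
  by rewrite lt0n; apply: contraTneq h => ->; rewrite muln0 -ltnNge.
case/card_gt0P => y /neighboursP[_ /set1P -> xy].
by apply/card_gt0P; exists y; rewrite inE.
Qed.

(** A leaf would leave fewer edges than vertices by [minimal_edges], which a
    graph with a cycle does not have; so all degrees are at least 2.  As there
    are at most as many edges as vertices, all degrees are exactly 2, hence
    the cycle is closed under adjacency and, by connectedness, is everything. *)
Lemma minimal_cyclic (G : sgraph) k r (c : seq G) : 0 < r -> r < k ->
  connected_graph G -> minimally_expanding k r (@adj G) ->
  2 < size c -> ucycle (@adj G) c -> isomorphic G (cycle_graph #|G|).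
Proof.
move=> r0 rk conn mG sc ucyc; have leE := card_edges_connected conn ucyc sc.
have no_leaf (x : G) : 1 < degree x.
  rewrite ltnNge; apply/negP => d1.
  have := expanding_degree x r0 mG.1; rewrite leq_eqVlt ltnNge d1 orbF eq_sym => /cards1P[p pE].
  have : #|edges G| <= #|~: [set x]|.
    apply: (minimal_edges rk mG); first by rewrite cards1.
    move=> _ /set1P ->; exists p => [|v xv].
      by have /setP/(_ p) := pE; rewrite !inE eqxx.
    by have /setP/(_ v) := pE; rewrite !inE xv => /esym/eqP.
  by rewrite cardsC1; have := conn.1; lia.
have leV : #|edges G| <= #|G|.
  have := @minimal_edges G k r set0 rk mG; rewrite cards0 setC0 cardsT; apply=> // l.
  by rewrite inE.
have deg2 (x : G) : degree x = 2.
  have := sum_degrees G; rewrite (bigD1 x) //=.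
  have : \sum_(u | u != x) 2 <= \sum_(u | u != x) degree u by apply: leq_sum.
  rewrite sum_nat_const cardC1; have := no_leaf x; have := conn.1.
  by move: (degree x) (\sum_(u | u != x) degree u) #|G| #|edges G| leV; lia.
have /andP[cyc uc] := ucyc.
have nbr (x : G) : x \in c -> [set y | adj x y] = [set next c x; prev c x].
  move=> xc; apply/esym/eqP; rewrite eqEcard -/(degree x) deg2; apply/andP; split.
    by rewrite subUset !sub1set !inE next_cycle //= adj_sym prev_cycle.
  rewrite cards2; case: eqP => // np.
  by have := next_next uc sc xc; rewrite np next_prev // eqxx.
have call (x : G) : x \in c.
  have [a ac] : exists a, a \in c.
    by case: c {leE ucyc cyc uc nbr} sc => // a s _; exists a; rewrite mem_head.
  have cl : closed (@adj G) [in c].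
    have h (u v : G) : adj u v -> u \in c -> v \in c.
      move=> uv uc'; have /setP/(_ v) := nbr u uc'.
      by rewrite !inE uv => /esym/orP[]/eqP ->; rewrite ?mem_next ?mem_prev.
    by move=> u v uv; apply/idP/idP; apply: h; rewrite // adj_sym.
  by rewrite -(closed_connect cl (conn.2 a x)).
apply: (hamilton_cycle_iso ucyc call) => x y.
have /setP/(_ y) := nbr x (call x); rewrite !inE => ->; congr (_ || _).
by apply/eqP/eqP => ->; rewrite ?next_prev ?prev_next.
Qed.

Lemma isomorphic_refl (G : sgraph) : isomorphic G G.
Proof. by exists id => //; exists id. Qed.

(** Deleting an edge destroys expansion, and by [isolated_expanding] this is
    seen by some set of vertices. *)
Lemma minimal_tree_class (G : sgraph) k r : 0 < r -> r < k ->
  is_tree G -> minimally_expanding k r (@adj G) -> tree_class k r G.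
Proof.
move=> r0 rk tG [he hmin]; split=> // [S|_ /edgesP[u [v [uv ->]]]].
  by have [_] := isolated_expanding G r0 (ltnW rk); apply.
have [/existsP //|/existsPn noS] :=
  boolP [exists S : {set remove_edge [set u; v]}, ~~ isolated_bound k r S].
have hr : expanding k r (@adj (remove_edge [set u; v])).
  by apply/isolated_expanding => [||S]; rewrite ?(ltnW rk) //; have := noS S; rewrite negbK.
have sub : subrel (@adj (remove_edge [set u; v])) (@adj G).
  by move=> x y /andP[].
have := hmin _ (@adj_sym (remove_edge [set u; v])) sub hr u v uv.
by rewrite /= /spanning_adj !inE eqxx andbF.
Qed.

Lemma minimal_connected_family (G : sgraph) k r : 0 < r -> r < k ->
  connected_graph G -> minimally_expanding k r (@adj G) ->
  exists2 H, cycle_tree_family k r H & isomorphic G H.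
Proof.
move=> r0 rk conn mG.
have [ac|] := pselect (acyclic_graph G).
  exists G; last exact: isomorphic_refl.
  by right; apply: minimal_tree_class.
move=> /existsNP[c /not_implyP[sc /contrapT ucyc]].
have isoC := minimal_cyclic r0 rk conn mG sc ucyc.
have [f bf ff] := isoC.
have m2 : 2 < #|G|.
  have /andP[_ uc] := ucyc; apply: leq_trans sc _.
  by rewrite -(card_uniqP uc); apply: max_card.
have mC : minimally_expanding k r (@cycle_adj #|G|) := minimal_iso bf ff mG.
have [i [mi i0 ki]] := minimal_cycle rk m2 mC.
exists (cycle_graph #|G|) => //; left; exists i; split=> //; last by rewrite mi.
rewrite -natrB ?(ltnW rk) // ltr_pdivlMr ?ltr0n ?subn_gt0 //.
by rewrite -natrM ltr_nat mulnC.
Qed.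

(** * Components of a minimal spanning subgraph *)

Lemma connect_adj_sym (G : sgraph) : connect_sym (@adj G).
Proof. by apply: sym_connect_sym; exact: adj_sym. Qed.

Lemma induced_connect (G : sgraph) (A : {set G}) :
  (forall u v : G, u \in A -> adj u v -> v \in A) ->
  forall u v : induced A, connect (@adj G) (val u) (val v) -> connect (@adj (induced A)) u v.
Proof.
move=> clA u [v vA] /connectP[p]; elim: p u => [|w p IH] u /=.
  by move=> _ vE; rewrite (_ : exist _ v vA = u) ?connect0 //; apply: val_inj.
move=> /andP[uw pth] vE.
have wA : w \in A := clA _ _ (valP u) uw.
by apply: connect_trans (IH (exist _ w wA) pth vE); apply: connect1.
Qed.

Lemma component_closed (G : sgraph) (x u v : G) :
  u \in [set y | connect (@adj G) x y] -> adj u v -> v \in [set y | connect (@adj G) x y].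
Proof. by rewrite !inE => xu uv; apply: connect_trans xu (connect1 uv). Qed.

Lemma component_connected (G : sgraph) (x : G) : connected_graph (component x).
Proof.
have xx : x \in [set y | connect (@adj G) x y] by rewrite inE connect0.
split=> [|u v]; first by apply/card_gt0P; exists (exist _ x xx).
apply: induced_connect => [a b|]; first exact: component_closed.
have := valP u; have := valP v; rewrite !inE => xv xu.
by apply: connect_trans xv; rewrite connect_adj_sym.
Qed.

(** A smaller expanding relation on the component is extended by all edges
    outside the component; neighbourhoods inside and outside the component are
    disjoint, so the result is expanding on the whole graph. *)
Lemma component_minimal (G : sgraph) (x : G) k r :
  minimally_expanding k r (@adj G) -> minimally_expanding k r (@adj (component x)).
Proof.
set A := [set y | connect (@adj G) x y].
have clA := @component_closed G x; rewrite -/A in clA.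
have clA' (u v : G) : adj u v -> (u \in A) = (v \in A).
  by move=> uv; apply/idP/idP => h; apply: clA h _; rewrite // adj_sym.
move=> [he hm]; split=> [X|e' es sub he' u v uv].
  have := he (val @: X); rewrite card_imset; last exact: val_inj.
  suff -> : neighbours (@adj G) (val @: X) = val @: neighbours (@adj (component x)) X.
    by rewrite card_imset //; apply: val_inj.
  apply/setP => y; apply/neighboursP/imsetP => [[_ /imsetP[a aX ->] ay]|].
    have yA : y \in A := clA _ _ (valP a) ay.
    by exists (exist _ y yA) => //; apply/neighboursP; exists a.
  by case=> b /neighboursP[a aX ab] ->; exists (val a); rewrite ?imset_f.
pose e2 : rel G := fun a b => adj a b && ((a \notin A) ||
  [exists u : component x, exists v : component x, [&& val u == a, val v == b & e' u v]]).
have e2s : symmetric e2.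
  have h a b : e2 a b -> e2 b a.
    case/andP=> ab h; rewrite /e2 adj_sym ab /= -(clA' _ _ ab).
    case/orP: h => [->//|/existsP[p /existsP[q /and3P[pa qb pq]]]].
    by apply/orP; right; apply/existsP; exists q; apply/existsP; exists p; rewrite pa qb es.
  by move=> a b; apply/idP/idP; apply: h.
have sub2 : subrel e2 (@adj G) by move=> a b /andP[].
have he2 : expanding k r e2.
  move=> X; pose X1 : {set component x} := [set u | val u \in X].
  have X1E : val @: X1 = X :&: A.
    apply/setP => a; rewrite inE; apply/imsetP/andP => [[p]|[aX aA]].
      by rewrite inE => pX ->; rewrite (valP p).
    by exists (exist _ a aA); rewrite ?inE.
  have sN : (val @: neighbours e' X1) :|: neighbours (@adj G) (X :\: A) \subset neighbours e2 X.
    apply/subsetP => b /setUP[/imsetP[q /neighboursP[p pX pq] ->]|/neighboursP[a /setDP[aX aA] ab]].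
      apply/neighboursP; exists (val p); first by rewrite inE in pX.
      rewrite /e2 [adj _ _](sub _ _ pq) /=; apply/orP; right.
      by apply/existsP; exists p; apply/existsP; exists q; rewrite !eqxx.
    by apply/neighboursP; exists a => //; rewrite /e2 ab aA.
  have dis : (val @: neighbours e' X1) :&: neighbours (@adj G) (X :\: A) = set0.
    apply/setP => b; rewrite in_setI in_set0; apply/negP => /andP[/imsetP[q _ ->]].
    case/neighboursP => a /setDP[_ aA] /clA' aq.
    by move: aA; rewrite aq (valP q).
  have := subset_leq_card sN; rewrite cardsU dis cards0 subn0 card_imset; last exact: val_inj.
  have := he' X1; have := he (X :\: A).
  have := cardsID A X; rewrite -X1E card_imset; last exact: val_inj.
  by move=> <- h1 h2 h3; apply: leq_trans (leq_mul (leqnn k) h3); rewrite !mulnDr leq_add.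
have := hm e2 e2s sub2 he2 _ _ (uv : adj (val u) (val v)).
rewrite /e2 (valP u) /= => /andP[_ /existsP[p /existsP[q /and3P[/eqP pu /eqP qv]]]].
by rewrite (val_inj pu) (val_inj qv).
Qed.

Lemma minimal_spanning (G : sgraph) k r : expanding k r (@adj G) ->
  exists2 E : {set {set G}}, E \subset edges G &
    minimally_expanding k r (@adj (spanning_subgraph E)).
Proof.
move=> he.
pose P (E : {set {set G}}) :=
  (E \subset edges G) && `[< expanding k r (@spanning_adj G E) >].
have PE : P (edges G).
  rewrite /P subxx; apply/asboolP.
  by rewrite (_ : @spanning_adj G _ = @adj G) //; apply/funext => u; apply/funext => v;
    rewrite /spanning_adj edge_set2 andbb.
have [E /minsetP[/andP[EG /asboolP hE] Emin] _] := minset_exists PE.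
exists E => //; split=> // e' es sub he' u v uv.
pose E' := [set e in E | [exists a, exists b, e' a b && (e == [set a; b])]].
have E'E : @spanning_adj G E' =2 e'.
  move=> a b; rewrite /spanning_adj inE; apply/idP/idP => [/and3P[ab _]|ab].
    case/existsP => p /existsP[q /andP[pq /eqP/setP eq]].
    have := eq a; have := eq b; have := eq p; have := eq q.
    rewrite !inE !eqxx !orbT !orTb.
    move=> /orP[]/eqP qE /orP[]/eqP pE; move: pq; rewrite qE pE //.
    - by move/sub => /andP[]; rewrite adj_irrefl.
    - by rewrite es.
    - by move/sub => /andP[]; rewrite adj_irrefl.
  have /andP[-> ->] := sub a b ab.
  by apply/existsP; exists a; apply/existsP; exists b; rewrite ab eqxx.
have sE : E' \subset E by apply/subsetP => e; rewrite inE => /andP[].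
have PE' : P E'.
  rewrite /P (subset_trans sE EG) /=; apply/asboolP.
  by rewrite (_ : @spanning_adj G E' = e') //; apply/funext => a; apply/funext => b.
by rewrite -E'E (Emin _ PE' sE).
Qed.

(** The components of a minimal expanding spanning subgraph are trees or odd
    cycles of the family. *)
Theorem isolated_bound_factor (G : sgraph) k r : 0 < r -> r < k ->
  (forall S : {set G}, isolated_bound k r S) -> has_factor (cycle_tree_family k r) G.
Proof.
move=> r0 rk /(isolated_expanding G r0 (ltnW rk)) he.
have [E EG mE] := minimal_spanning he.
exists E => // x; apply: (minimal_connected_family r0 rk); first exact: component_connected.
exact: component_minimal.
Qed.

(** * The largest eigenvalue of the signless Laplacian *)

Section SpectralRadius.
Import Num.Def.
Local Open Scope ring_scope.
Local Open Scope sesquilinear_scope.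

(** Diagonalise over the complex numbers: the eigenvalues of a real symmetric
    matrix are real, and in the unitary eigenbasis the quadratic form is a
    combination of squared moduli with these eigenvalues as coefficients. *)
Lemma symmetric_max_eigenvalue (R : rcfType) n (A : 'M[R]_n) : (0 < n)%N -> A^T = A ->
  exists2 l, eigenvalue A l &
    forall v : 'rV[R]_n, (v *m A *m v^T) 0 0 <= l * (v *m v^T) 0 0.
Proof.
move=> n0 symA.
pose f : {rmorphism R -> complex R} := real_complex R.
pose B := map_mx f A.
have realf m p (M : 'M[R]_(m, p)) : map_mx conjC (map_mx f M) = map_mx f M.
  apply/matrixP => i j; rewrite !mxE; apply/CrealP.
  by apply/complex_realP; exists (M i j).
have hB : B \is hermsymmx.
  apply: realsym_hermsym.
    rewrite qualifE /= /B expr0 scale1r map_mx_id //.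
    by apply/eqP/matrixP => i j; rewrite !mxE -{1}symA mxE.
  by apply/mxOverP => i j; rewrite mxE; apply/complex_realP; exists (A i j).
have /orthomx_spectralP BE := hermitian_normalmx hB.
have dR := hermitian_spectral_diag_real hB.
move: BE dR (spectral_unitarymx B).
set P := spectralmx B; set d := spectral_diag B => BE dR Pu.
have dE i : d 0 i = f (complex.Re (d 0 i)).
  by move/mxOverP/(_ 0 i)/complex_realP: dR => [x ->].
have BE' : B = P^t* *m diag_mx d *m P by rewrite BE -(invmx_unitary Pu).
have PP : P *m P^t* = 1%:M by apply/unitarymxP.
have PP' : P^t* *m P = 1%:M by rewrite -(invmx_unitary Pu) mulVmx // unitarymx_unit.
have [i0 imax] : exists i0, forall i, complex.Re (d 0 i) <= complex.Re (d 0 i0).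
  case: (@Order.TotalTheory.arg_maxP _ _ _ (Ordinal n0) xpredT (fun i => complex.Re (d 0 i)) isT) => i _ h.
  by exists i => j; apply: h.
exists (complex.Re (d 0 i0)).
  rewrite -(eigenvalue_map f) -/B -dE; apply/eigenvalueP; exists (row i0 P).
    rewrite -row_mul BE' !mulmxA PP mul1mx.
    by rewrite mul_diag_mx; apply/rowP => j; rewrite !mxE.
  apply/eqP => r0; have /rowP/(_ i0) : row i0 P *m P^t* = 0 by rewrite r0 mul0mx.
  by rewrite -row_mul PP !mxE eqxx => /eqP; rewrite oner_eq0.
move=> v; rewrite -lecR.
(* the coordinates of v in the eigenbasis *)
pose y := map_mx f v *m P^t*.
have yE : P *m (map_mx f v)^T = y^t*.
  by rewrite /y trmx_mul map_mxM trmxCK -map_trmx realf.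
have fE (M : 'M[R]_1) : f (M 0 0) = (map_mx f M) 0 0 by rewrite mxE.
have vT : map_mx f v^T = (map_mx f v)^T by rewrite map_trmx.
rewrite rmorphM /= !fE !map_mxM /= -/B BE' vT !mulmxA -/y -[_ *m P *m _]mulmxA yE.
have -> : map_mx f v *m (map_mx f v)^T = y *m y^t*.
  by rewrite -yE /y mulmxA -(mulmxA _ _ P) PP' mulmx1.
rewrite !mxE mulr_sumr; apply: ler_sum => i _.
rewrite mul_mx_diag !mxE mulrAC mulrC ler_wpM2r //; first exact: mul_conjC_ge0.
by rewrite dE lecR.
Qed.
End SpectralRadius.

Section QuadraticForm.
Local Open Scope ring_scope.

Section Laplacian.
Variables (R : realType) (G : sgraph).
Implicit Types x y z : G -> R.

(** The signless Laplacian as an operator on functions on the vertices. *)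
Definition qapply x (u : G) : R := \sum_(v | adj u v) (x u + x v).
Definition qform x y : R := \sum_u x u * qapply y u.
Definition sqnorm x : R := \sum_u x u ^+ 2.

Let rowv x : 'rV[R]_#|G| := \row_i x (enum_val i).

Let sum_ord (F : G -> R) : \sum_(i < #|G|) F (enum_val i) = \sum_u F u.
Proof. by rewrite [RHS](reindex _ (onW_bij _ (@enum_val_bij G))). Qed.

Let rowvP (v : 'rV[R]_#|G|) : v = rowv (fun u => v 0 (enum_rank u)).
Proof. by apply/rowP => i; rewrite mxE enum_valK. Qed.

Lemma qapplyE x u : qapply x u = (degree u)%:R * x u + \sum_(v | adj u v) x v.
Proof.
rewrite /qapply big_split /= sumr_const mulr_natl; congr (_ *+ _ + _).
by apply: eq_card => v; rewrite inE.
Qed.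

Let rowv_mul x : rowv x *m signless_laplacian R G = rowv (qapply x).
Proof.
apply/rowP => j; rewrite !mxE.
under eq_bigr => i _ do rewrite !mxE mulrDr.
rewrite big_split /= qapplyE; congr (_ + _).
  rewrite (bigD1 j) //= eqxx mulr1n mulrC big1 ?addr0 // => i /negPf ij.
  by rewrite ij mulr0n mulr0.
rewrite (sum_ord (fun v => x v * (adj v (enum_val j))%:R)) [RHS]big_mkcond.
by apply: eq_bigr => v _; rewrite adj_sym; case: ifP; rewrite ?mulr1 ?mulr0.
Qed.

Let rowv_dot x y : (rowv x *m (rowv y)^T) 0 0 = \sum_u x u * y u.
Proof.
by rewrite mxE -sum_ord; apply: eq_bigr => i _; rewrite !mxE.
Qed.

Let rowv_eq0 x : (rowv x != 0) <-> exists u, x u != 0.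
Proof.
split=> [|[u]].
  case/rV0Pn => i; rewrite mxE => h; by exists (enum_val i).
by apply: contraNneq => /rowP/(_ (enum_rank u)); rewrite !mxE enum_rankK => ->.
Qed.

Lemma eigenvalue_qapply l : eigenvalue (signless_laplacian R G) l <->
  exists2 x, (exists u, x u != 0) & forall u, qapply x u = l * x u.
Proof.
split=> [/eigenvalueP[v vl v0]|[x /rowv_eq0 x0 xl]].
  rewrite (rowvP v) in vl v0; eexists; first exact/rowv_eq0/v0.
  move=> u; move: vl; rewrite rowv_mul => /rowP/(_ (enum_rank u)).
  by rewrite !mxE !enum_rankK.
apply/eigenvalueP; exists (rowv x) => //; rewrite rowv_mul.
by apply/rowP => i; rewrite !mxE xl.
Qed.

Lemma signless_laplacian_sym : (signless_laplacian R G)^T = signless_laplacian R G.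
Proof.
apply/matrixP => i j; rewrite !mxE adj_sym eq_sym; congr (_ + _).
by case: eqP => // ->.
Qed.

Lemma sqnorm_gt0 x u : x u != 0 -> 0 < sqnorm x.
Proof.
move=> xu; rewrite /sqnorm (bigD1 u) //= ltr_wpDr ?exprn_even_gt0 //.
by apply: sumr_ge0 => v _; exact: sqr_ge0.
Qed.

(** This identifies the supremum [q_radius] with the largest Rayleigh quotient. *)
Lemma q_radius_max : (0 < #|G|)%N ->
  eigenvalue (signless_laplacian R G) (q_radius R G) /\
  forall x, qform x x <= q_radius R G * sqnorm x.
Proof.
move=> G0; have [l le lmax] := symmetric_max_eigenvalue G0 signless_laplacian_sym.
have rl x : qform x x <= l * sqnorm x.
  have := lmax (rowv x); rewrite rowv_mul !rowv_dot.
  rewrite /qform /sqnorm; under eq_bigr => u _ do rewrite mulrC.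
  by under [X in _ <= _ * X]eq_bigr => u _ do rewrite -expr2.
suff -> : q_radius R G = l by [].
have ub : ubound [set x : R | eigenvalue (signless_laplacian R G) x]%classic l.
  move=> m /= /eigenvalue_qapply[x [u xu] xm].
  have h := rl x; rewrite -(ler_pM2r (sqnorm_gt0 xu)); move: h.
  by apply: le_trans; rewrite /qform /sqnorm mulr_sumr ler_sum // => v _; rewrite xm; lra.
apply/eqP; rewrite eq_le ge_sup ?ub_le_sup //; first by exists l.
by exists l.
Qed.

Lemma qform_sym x y : qform x y = qform y x.
Proof.
rewrite /qform; under eq_bigr => u _ do rewrite qapplyE mulrDr.
under [RHS]eq_bigr => u _ do rewrite qapplyE mulrDr.
rewrite !big_split /=; congr (_ + _); first by apply: eq_bigr => u _; ring.
under eq_bigr => u _ do rewrite mulr_sumr.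
under [RHS]eq_bigr => u _ do rewrite mulr_sumr.
rewrite (exchange_big_dep predT) //=; apply: eq_bigr => u _.
under eq_bigl => v do rewrite adj_sym.
by apply: eq_bigr => v _; rewrite mulrC.
Qed.

Lemma qform_energy x : qform x x *+ 2 = \sum_u \sum_(v | adj u v) (x u + x v) ^+ 2.
Proof.
have swap : qform x x = \sum_u \sum_(v | adj u v) x v * (x u + x v).
  rewrite (exchange_big_dep predT) //= /qform; apply: eq_bigr => u _.
  rewrite /qapply mulr_sumr; under eq_bigl => v do rewrite adj_sym.
  by apply: eq_bigr => v _; rewrite addrC.
rewrite mulr2n {2}swap /qform -big_split /=; apply: eq_bigr => u _.
by rewrite /qapply mulr_sumr -big_split /=; apply: eq_bigr => v _; ring.
Qed.

(** If [x] is an eigenvector for the largest eigenvalue [q], replacing it by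
    [y = |x|] does not decrease the energy, so [y] also maximises the Rayleigh
    quotient.  Where [y] vanishes, so does the derivative of the quotient in
    that coordinate; thus [y] vanishes at all neighbours as well, and by
    connectedness everywhere. *)
Lemma perron_vector : connected_graph G ->
  exists2 y, (forall u, 0 < y u) & qform y y = q_radius R G * sqnorm y.
Proof.
move=> [G0 conn]; have [ev rl] := q_radius_max G0.
have [x [u0 xu0] xq] := (eigenvalue_qapply _).1 ev.
set q := q_radius R G in rl xq *.
pose y u := `|x u|.
have y0 u : 0 <= y u by exact: normr_ge0.
have yn : sqnorm y = sqnorm x by apply: eq_bigr => u _; rewrite /y -normrX ger0_norm ?sqr_ge0.
have yq : qform y y = q * sqnorm y.
  apply/eqP; rewrite eq_le rl /= yn.
  have -> : q * sqnorm x = qform x x.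
    by rewrite /qform /sqnorm mulr_sumr; apply: eq_bigr => u _; rewrite xq; ring.
  rewrite -(@ler_pMn2r _ 2) // !qform_energy; apply: ler_sum => u _; apply: ler_sum => v _.
  by rewrite -(ger0_norm (sqr_ge0 (x u + x v))) normrX lerXn2r ?nnegrE ?addr_ge0 // ler_normD.
exists y => // u; rewrite lt_neqAle y0 andbT; apply/negP => /eqP/esym yu.
have zero a : y a = 0 -> qapply y a = 0.
  move=> ya; pose z v : R := (v == a)%:R.
  have zy w : qform z w = qapply w a.
    rewrite /qform (bigD1 a) //= /z eqxx mul1r big1 ?addr0 // => v /negPf ->.
    by rewrite mul0r.
  have s0 : 0 <= qapply y a by apply: sumr_ge0 => v _; exact: addr_ge0.
  apply/eqP; rewrite eq_le s0 andbT leNgt; apply/negP => s1.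
  (* the Rayleigh inequality for the perturbation y + t z of the maximiser y *)
  have key t : 2 * t * qapply y a + t ^+ 2 * qform z z <= q * t ^+ 2.
    have := rl (fun v => y v + t * z v).
    have -> : sqnorm (fun v => y v + t * z v) = sqnorm y + t ^+ 2.
      rewrite /sqnorm (bigD1 a) //= [in RHS](bigD1 a) //= /z eqxx ya.
      under eq_bigr => v /negPf -> do rewrite mulr0 addr0.
      rewrite -[true%:R]/(1 : R); ring.
    have -> : qform (fun v => y v + t * z v) (fun v => y v + t * z v) =
       qform y y + 2 * t * qapply y a + t ^+ 2 * qform z z.
      have lin w : qform w (fun v => y v + t * z v) = qform w y + t * qform w z.
        rewrite /qform mulr_sumr -big_split /=; apply: eq_bigr => v _.
        rewrite /qapply !mulr_sumr -big_split /=; apply: eq_bigr => v' _; ring.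
      rewrite lin [qform _ y]qform_sym [qform _ z]qform_sym !lin (qform_sym y z) !zy; ring.
    by rewrite yq mulrDr; lra.
  pose c := q - qform z z.
  have kc t : 0 < t -> 2 * qapply y a <= c * t.
    move=> t0; rewrite -(ler_pM2r t0) /c; have := key t; rewrite !expr2; lra.
  have c0 : 0 < c by have := kc 1 ltr01; lra.
  by have := kc (qapply y a / c) (divr_gt0 s1 c0); rewrite mulrCA divff ?gt_eqF // mulr1; lra.
have cl : closed (@adj G) [pred v | y v == 0].
  have h a b : adj a b -> y a == 0 -> y b == 0.
    move=> ab /eqP ya; have /eqP := zero a ya.
    rewrite psumr_eq0 => [/allP/(_ b)|v _]; last exact: addr_ge0.
    by rewrite mem_index_enum ab ya add0r; apply.
  by move=> a b ab; rewrite !inE; apply/idP/idP; apply: h; rewrite // adj_sym.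
have := closed_connect cl (conn u u0); rewrite !inE yu eqxx => /esym.
by rewrite /y normr_eq0 (negPf xu0).
Qed.

(** This is the row sum bound for the matrix conjugated by the diagonal of
    degrees: compare the eigenvalue equation at a vertex where
    [|x u| / degree u] is largest. *)
Lemma q_radius_le_row_sums (B : R) : (0 < #|G|)%N -> (forall u : G, (0 < degree u)%N) ->
  (forall u : G, (degree u)%:R ^+ 2 + \sum_(v | adj u v) (degree v)%:R <= B * (degree u)%:R) ->
  q_radius R G <= B.
Proof.
move=> G0 d0 hB; have [ev _] := q_radius_max G0.
have [x [u0 xu0] xq] := (eigenvalue_qapply _).1 ev.
set q := q_radius R G in xq *.
have dp (u : G) : 0 < (degree u)%:R :> R by rewrite ltr0n d0.
pose g u := `|x u| / (degree u)%:R.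
case: (@Order.TotalTheory.arg_maxP _ _ _ u0 xpredT g isT) => u _ gmax.
have g0 : 0 < g u.
  by apply: lt_le_trans (gmax u0 isT); rewrite divr_gt0 ?normr_gt0.
have xg v : `|x v| <= g u * (degree v)%:R by rewrite -ler_pdivrMr //; apply: gmax.
have xu : `|x u| = g u * (degree u)%:R by rewrite /g divfK // gt_eqF.
have := hB u; rewrite -(ler_pM2l g0) => hu.
have : q * (g u * (degree u)%:R) <= g u * (B * (degree u)%:R).
  apply: le_trans hu; rewrite -xu; apply: le_trans (ler_norm _) _.
  rewrite normrM normr_id -normrM -xq qapplyE; apply: le_trans (ler_normD _ _) _.
  rewrite normrM normr_nat xu mulrDr lerD //; first by rewrite expr2; lra.
  rewrite mulr_sumr; apply: le_trans (ler_norm_sum _ _ _) _.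
  by apply: ler_sum => v _; exact: xg.
by rewrite mulrCA ler_pM2l // ler_pM2r.
Qed.

(** The bound of Feng and Yu.  Let [N] be the order minus one, [D] the sum of
    all degrees, [d] the degree of [u] and [s] the sum of the degrees of its
    neighbours.  Then [s] is at most [d * N], and at most [D - N] because each
    vertex other than [u] and its neighbours has degree at least one.  Either
    estimate may be the better one; in both cases
    [d ^ 2 + s <= (N + (D - N) / N) * d]. *)
Lemma q_radius_le_size : (1 < #|G|)%N -> (forall u : G, (0 < degree u)%N) ->
  q_radius R G <= (#|G|%:R - 2) + (\sum_(u : G) degree u)%:R / (#|G|%:R - 1).
Proof.
move=> G1 d0; apply: q_radius_le_row_sums => //; first exact: ltnW.
move=> u.
set N : R := #|G|%:R - 1; set D : R := (\sum_u degree u)%:R; set d : R := (degree u)%:R.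
set s := \sum_(v | _) _.
have N0 : 0 < N by rewrite subr_gt0 ltr1n.
have dn (v : G) : (degree v)%:R <= N.
  rewrite /N lerBrDr natr1 ler_nat.
  by apply: (@leq_trans #|v |: [set y | adj v y]|); [rewrite cardsU1 inE adj_irrefl|exact: max_card].
have d1 : 1 <= d by rewrite ler1n.
have s1 : s <= d * N.
  apply: (@le_trans _ _ (\sum_(v | adj u v) N)); first by apply: ler_sum.
  rewrite sumr_const -[leLHS]mulr_natl ler_pM2r // ler_nat.
  by rewrite /degree; apply: eq_leq; apply: eq_card => v; rewrite inE.
have s2 : s <= D - N.
  have DE : D = d + s + \sum_(v | (v != u) && ~~ adj u v) (degree v)%:R.
    rewrite /D natr_sum (bigD1 u) //= -addrA; congr (_ + _).
    rewrite (bigID (adj u)) /=; congr (_ + _); apply: eq_bigl => v.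
    by apply: andb_idl; apply: contraTneq => ->; rewrite adj_irrefl.
  have : \sum_(v | (v != u) && ~~ adj u v) 1 <= \sum_(v | (v != u) && ~~ adj u v) (degree v)%:R :> R.
    by apply: ler_sum => v _; rewrite ler1n.
  rewrite sumr_const DE.
  suff -> : #|[pred v | (v != u) && ~~ adj u v]|%:R = N - d by lra.
  have : (#|[pred v | (v != u) && ~~ adj u v]| + degree u + 1 = #|G|)%N.
    rewrite -(cardC [pred v | (v != u) && ~~ adj u v]) -addnA; congr (_ + _)%N.
    rewrite (_ : (degree u + 1)%N = #|u |: [set y | adj u y]|); last first.
      by rewrite cardsU1 inE adj_irrefl addnC.
    by apply: eq_card => v; rewrite !inE negb_and !negbK.
  by move=> h; rewrite /N -h !natrD /d; lra.
have -> : #|G|%:R - 2 + D / N = N + (D - N) / N :> R.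
  by rewrite mulrBl divff ?gt_eqF // /N; lra.
set M := D - N in s2 *.
have MN : M = M / N * N by rewrite divfK ?gt_eqF.
have dN : d <= N := dn u.
rewrite mulrDl; move: (M / N) MN => t MN.
have [tle|tgt] := leP t d; nra.
Qed.

(** Evaluate the Rayleigh quotient at the indicator function of [A]: it is
    [#|A| - 1] plus the average degree in [A].  The edge from [a] to [b] makes
    the degree of [a] exceed [#|A| - 1]. *)
Lemma q_radius_gt_clique (A : {set G}) : (exists a b, [/\ a \in A, b \notin A & adj a b]) ->
  {in A &, forall a b, a != b -> adj a b} ->
  2 * (#|A|%:R - 1) < q_radius R G.
Proof.
move=> [a [b [aA bA ab]]] clq.
have G0 : (0 < #|G|)%N by apply/card_gt0P; exists a.
have [_ /(_ (fun u => (u \in A)%:R))] := q_radius_max G0.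
have A0 : 0 < #|A|%:R :> R by rewrite ltr0n; apply/card_gt0P; exists a.
have -> : sqnorm (fun u => (u \in A)%:R) = #|A|%:R.
  rewrite /sqnorm -sum1_card natr_sum [RHS]big_mkcond; apply: eq_bigr => u _.
  by case: (u \in A); rewrite ?expr1n ?expr0n.
rewrite mulrC -ler_pdivrMl // mulrC; apply: lt_le_trans; rewrite ltr_pdivlMr //.
have nb (u : G) : u \in A -> A :\ u \subset [set v | adj u v].
  by move=> uA; apply/subsetP => v; rewrite !inE => /andP[vu vA]; apply: clq; rewrite // eq_sym.
have qE (u : G) : u \in A -> qapply (fun u => (u \in A)%:R) u = (degree u)%:R + (#|A|%:R - 1).
  move=> uA; rewrite qapplyE uA mulr1; congr (_ + _).
  rewrite -natr_sum -big_mkcondr /= sum1dep_card.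
  rewrite (cardsD1 u A) uA natrD addrC addKr; congr _%:R.
  apply: eq_card => v; rewrite !inE; apply/andP/andP => [[uv vA]|[vu vA]].
    by split=> //; apply: contraTneq uv => ->; rewrite adj_irrefl.
  by split=> //; apply: clq; rewrite // eq_sym.
have -> : qform (fun u => (u \in A)%:R) (fun u => (u \in A)%:R) =
    \sum_(u in A) ((degree u)%:R + (#|A|%:R - 1)).
  rewrite /qform [RHS]big_mkcond; apply: eq_bigr => u _.
  by case: ifP => [/qE ->|]; rewrite ?mul1r ?mul0r.
have dge (u : G) : u \in A -> #|A|%:R - 1 <= (degree u)%:R :> R.
  move=> uA; rewrite lerBlDr natr1 ler_nat (cardsD1 u A) uA ltnS.
  exact/subset_leq_card/nb.
have dgt : #|A|%:R - 1 < (degree a)%:R :> R.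
  rewrite ltrBlDr natr1 ltr_nat (cardsD1 a A) aA ltnS.
  apply: proper_card; apply/properP; split; first exact: nb.
  by exists b; rewrite !inE // (negPf bA) andbF.
have -> : 2 * (#|A|%:R - 1) * #|A|%:R = \sum_(u in A) (2 * (#|A|%:R - 1)) :> R.
  by rewrite sumr_const mulr_natr.
rewrite (bigD1 a) //= [ltRHS](bigD1 a) //=; apply: ltr_leD; first lra.
by apply: ler_sum => u /andP[/dge uA _]; lra.
Qed.
End Laplacian.

(** A positive Perron vector of [G] has strictly larger energy on [H]. *)
Lemma q_radius_lt_supergraph (R : realType) (G H : sgraph) (f : G -> H) (a b : G) :
  connected_graph G -> bijective f -> (forall u v, adj u v -> adj (f u) (f v)) ->
  adj (f a) (f b) -> ~~ adj a b -> q_radius R G < q_radius R H.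
Proof.
move=> conn bf hom fab nab; have [y y0 yq] := perron_vector R conn.
have [g fK gK] := bf.
have H0 : (0 < #|H|)%N by apply/card_gt0P; exists (f a).
have [_ /(_ (y \o g))] := q_radius_max R H0.
have -> : sqnorm (y \o g) = sqnorm y.
  rewrite /sqnorm [LHS](reindex f (onW_bij _ bf)) /=; apply: eq_bigr => u _; by rewrite fK.
have n0 : 0 < sqnorm y by apply: (@sqnorm_gt0 _ _ _ a); rewrite gt_eqF.
move=> h; rewrite -(ltr_pM2r n0) -yq; apply: lt_le_trans h; rewrite -(@ltr_pMn2r _ 2) // !qform_energy.
rewrite [ltRHS](reindex f (onW_bij _ bf)) /=.
have step (u : G) : \sum_(v | adj u v) (y u + y v) ^+ 2 <=
    \sum_(v | adj (f u) v) (y (g (f u)) + y (g v)) ^+ 2.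
  rewrite [leRHS](reindex f (onW_bij _ bf)) /= [leRHS](bigID (adj u)) /=.
  rewrite [X in _ <= X + _](eq_bigl (adj u)) => [|v]; last by apply: andb_idl; exact: hom.
  under [X in _ <= X + _]eq_bigr => v _ do rewrite !fK.
  by rewrite lerDl; apply: sumr_ge0 => v _; exact: sqr_ge0.
rewrite (bigD1 a) //= [ltRHS](bigD1 a) //=; apply: ltr_leD; last exact: ler_sum.
rewrite [ltRHS](reindex f (onW_bij _ bf)) /= [ltRHS](bigID (adj a)) /=.
rewrite [X in _ < X + _](eq_bigl (adj a)) => [|v]; last by apply: andb_idl; exact: hom.
under [X in _ < X + _]eq_bigr => v _ do rewrite !fK.
rewrite ltrDl (bigD1 b) /= ?fab // ltr_wpDr //.
  by apply: sumr_ge0 => v _; exact: sqr_ge0.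
by rewrite !fK exprn_gt0 // addr_gt0.
Qed.
End QuadraticForm.

(** * Comparison of the two spectral bounds *)

Section Comparison.
Local Open Scope ring_scope.

Section Numeric.
Variable R : realFieldType.
Implicit Types t n d s p b x : R.

Lemma convex_quadratic_le0 (c e f a b x : R) : 0 <= c -> a <= x <= b ->
  c * a ^+ 2 + e * a + f <= 0 -> c * b ^+ 2 + e * b + f <= 0 ->
  c * x ^+ 2 + e * x + f <= 0.
Proof.
move=> c0 /andP[ax xb] fa fb.
have [ab|ab] := leP b a; first by rewrite (_ : x = a) //; lra.
have : (b - a) * (c * x ^+ 2 + e * x + f) <= 0.
  have -> : (b - a) * (c * x ^+ 2 + e * x + f) =
    (b - x) * (c * a ^+ 2 + e * a + f) + (x - a) * (c * b ^+ 2 + e * b + f)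
    - c * ((x - a) * (b - x) * (b - a)) by ring.
  have h1 : (b - x) * (c * a ^+ 2 + e * a + f) <= 0 by rewrite mulr_ge0_le0 ?subr_ge0.
  have h2 : (x - a) * (c * b ^+ 2 + e * b + f) <= 0 by rewrite mulr_ge0_le0 ?subr_ge0.
  have h3 : 0 <= c * ((x - a) * (b - x) * (b - a)).
    by rewrite !mulr_ge0 ?subr_ge0 // ltW.
  lra.
by rewrite pmulr_rle0 ?subr_gt0.
Qed.

(** The two lower bounds on [n] together give the one needed at the right end
    of the range of [s] in [size_bound].  For [d = 1] this is the first bound.
    For [d >= 2] it follows from the second: once both are made bounds on
    [2 * (t - 1) * t ^+ 2 * n], their difference is a polynomial in [t - 1] and
    [d - 2] with positive coefficients. *)
Lemma order_bound t n (d : nat) : 1 < t -> (0 < d)%N ->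
  (t + 1) * (t + 2) * (t * d%:R + t + 1) <= t ^+ 2 * n ->
  (t ^+ 2 + 2 * t) * d%:R ^+ 2 + (2 * t ^+ 2 + 3 * t + 2) * d%:R + t ^+ 2 + 3 * t
    <= 2 * (t - 1) * n ->
  (1 + t) * (2 * t * (1 + t) * d%:R + 3 * t + 2) <= t ^+ 2 * n.
Proof.
move=> t1; case: d => // -[_ c1 _|d _ _ c2]; first by lra.
have t0 : 0 < 2 * (t - 1) by lra.
rewrite -(ler_pM2l t0); have t2 : 0 <= t ^+ 2 by rewrite sqr_ge0.
have := ler_wpM2l t2 c2; rewrite [in X in _ <= X -> _]mulrCA; apply: le_trans.
have := ler0n R d; rewrite -!(@natr1 R d.+1) -!(@natr1 R d).
move: (d%:R) => e e0; have [u [u0 ->]] : exists u, 0 <= u /\ t = u + 1.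
  by exists (t - 1); split; lra.
rewrite -subr_ge0.
set D := (X in 0 <= X).
have -> : D = (30 + 43 * u + 23 * u ^+ 2 + 7 * u ^+ 3 + u ^+ 4)
    + (19 + 45 * u + 39 * u ^+ 2 + 15 * u ^+ 3 + 2 * u ^+ 4) * e
    + (3 + 10 * u + 12 * u ^+ 2 + 6 * u ^+ 3 + u ^+ 4) * e ^+ 2 by rewrite /D; ring.
by rewrite !(addr_ge0, mulr_ge0, exprn_ge0, ler0n).
Qed.

(** The left side bounds the sum of degrees of a graph of order [n] with [p]
    vertices whose neighbours all lie in a set of size [s].  Replacing [p] by
    [t * s] increases it as long as [t * s <= n - 1 - s]; the result is convex
    in [s], so only the ends [d + 1] and [b := n / (t + 1)] of the range of [s]
    matter.  At the first end the claim follows from the second lower bound on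
    [n], at the other from [order_bound].  For larger [t * s], being an integer
    above [t * s] forces [p = n - s]; then the left side increases in [s] and
    has at [s = b] the same value as before. *)
Lemma size_bound (t : R) (n d s p p0 : nat) : 1 < t -> (0 < d)%N -> (d < s)%N ->
  (s + p <= n)%N -> t * s%:R < p%:R -> p0%:R <= t * d%:R + 1 ->
  (t + 1) * (t + 2) * (t * d%:R + t + 1) <= t ^+ 2 * n%:R ->
  (t ^+ 2 + 2 * t) * d%:R ^+ 2 + (2 * t ^+ 2 + 3 * t + 2) * d%:R + t ^+ 2 + 3 * t
    <= 2 * (t - 1) * n%:R ->
  (n%:R - p%:R) * (n%:R - p%:R - 1) + 2 * p%:R * s%:R
    <= (n%:R - 1) * (n%:R - 2 * p0%:R) :> R.
Proof.
move=> t1 d0 ds spn tsp p0d c1 c2; have c3 := order_bound t1 d0 c1 c2.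
pose b := n%:R / (t + 1); have nb : n%:R = b * (t + 1) by rewrite /b divfK // gt_eqF //; lra.
have spn' : s%:R + p%:R <= n%:R :> R by rewrite -natrD ler_nat.
have ds' : d%:R + 1 <= s%:R :> R by rewrite natr1 ler_nat.
have d1 : 1 <= d%:R :> R by rewrite ler1n.
have sb : s%:R <= b.
  have : s%:R * (t + 1) <= b * (t + 1) by rewrite -nb; lra.
  by rewrite ler_pM2r //; lra.
have n1 : 1 <= n%:R :> R by have := ler0n R p; lra.
pose C : R := (n%:R - 1) * (n%:R - 2 * (t * d%:R + 1)).
apply: (@le_trans _ _ C); last by rewrite /C ler_wpM2l; lra.
have b0 : 0 <= b by lra.
have atb : (1 + 2 * t) * b ^+ 2 - b <= C.
  have : 0 <= b * (t ^+ 2 * n%:R - (1 + t) * (2 * t * (1 + t) * d%:R + 3 * t + 2)) by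
    rewrite mulr_ge0 // subr_ge0.
  have td0 : 0 <= t * d%:R by rewrite mulr_ge0 ?ler0n //; lra.
  rewrite /C nb => h.
  have h2 : 0 <= b * (t ^+ 2 * b - ((2 * t * (1 + t) * d%:R + 3 * t + 2))).
    have tp : 0 < t + 1 by lra.
    rewrite -(pmulr_lge0 _ tp); move: h; congr (is_true (_ <= _)); ring.
  have : C - ((1 + 2 * t) * b ^+ 2 - b) = b * (t ^+ 2 * b - ((2 * t * (1 + t) * d%:R + 3 * t + 2)))
    + 2 * (t * d%:R) + 2 by rewrite /C nb; ring.
  rewrite /C nb; lra.
have [low|high] := leP (t * s%:R) (n%:R - 1 - s%:R).
  apply: (@le_trans _ _ ((n%:R - t * s%:R) * (n%:R - t * s%:R - 1) + 2 * (t * s%:R) * s%:R)).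
    by rewrite -subr_ge0; have : 0 <= (p%:R - t * s%:R) * (2 * n%:R - 1 - 2 * s%:R - t * s%:R - p%:R)
      by [rewrite mulr_ge0; lra]; congr (is_true (_ <= _)); ring.
  have := @convex_quadratic_le0 (t ^+ 2 + 2 * t) (- ((2 * n%:R - 1) * t)) (n%:R ^+ 2 - n%:R - C)
    (d%:R + 1) b s%:R.
  have -> : (t ^+ 2 + 2 * t) * s%:R ^+ 2 + - ((2 * n%:R - 1) * t) * s%:R + (n%:R ^+ 2 - n%:R - C) =
    (n%:R - t * s%:R) * (n%:R - t * s%:R - 1) + 2 * (t * s%:R) * s%:R - C by ring.
  rewrite subr_le0; apply.
  - by rewrite addr_ge0 ?sqr_ge0 //; lra.
  - by rewrite ds' sb.
  - rewrite /C; nra.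
  - move: atb; rewrite -subr_le0; congr (is_true (_ <= _)).
    by rewrite nb; ring.
have pE : p%:R = n%:R - s%:R :> R.
  have : (n <= p + s)%N.
    by rewrite -ltnS -(ltr_nat R) -natr1 natrD; lra.
  by rewrite -(ler_nat R) natrD; lra.
rewrite pE; apply: le_trans atb.
have : 0 <= (b - s%:R) * (2 * n%:R - 1 - (b + s%:R)).
  rewrite mulr_ge0 ?subr_ge0 //.
  have : 2 * b <= n%:R by rewrite nb; nra.
  lra.
move=> h; rewrite -subr_ge0; move: h; congr (is_true (_ <= _)); rewrite nb; ring.
Qed.

End Numeric.
End Comparison.

(** * Graphs with many isolated vertices outside a small set *)

Lemma injection_of_fibres (A B : finType) (K : eqType) (c1 : A -> K) (c2 : B -> K) :
  (forall i, #|[pred x | c1 x == i]| = #|[pred y | c2 y == i]|) ->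
  exists2 f : A -> B, injective f & forall x, c2 (f x) = c1 x.
Proof.
move=> eqc.
pose g i x (h : x \in [pred x | c1 x == i]) := enum_val (cast_ord (eqc i) (enum_rank_in h x)).
have gc i x h : c2 (@g i x h) = i.
  by apply/eqP; have := enum_valP (cast_ord (eqc i) (enum_rank_in h x)); rewrite inE.
have gi i j x y h h' : i = j -> @g i x h = @g j y h' -> x = y.
  move=> ij; subst j => /enum_val_inj/cast_ord_inj/(congr1 enum_val).
  by rewrite !enum_rankK_in.
have fx x : x \in [pred x' | c1 x' == c1 x] by rewrite inE.
exists (fun x => g _ _ (fx x)) => [x y eq|x]; last exact: gc.
by apply: (gi _ _ _ _ _ _ _ eq); rewrite -(gc _ _ (fx x)) eq gc.
Qed.

Lemma bijection_of_fibres (A B : finType) (K : eqType) (c1 : A -> K) (c2 : B -> K) :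
  (forall i, #|[pred x | c1 x == i]| = #|[pred y | c2 y == i]|) ->
  exists2 f : A -> B, bijective f & forall x, c2 (f x) = c1 x.
Proof.
move=> eqc; have [f fi fc] := injection_of_fibres eqc.
have [g gi _] := injection_of_fibres (fun i => esym (eqc i)).
by exists f => //; apply: inj_card_bij fi _; exact: leq_card gi.
Qed.

Lemma exists_subset_card (T : finType) (A : {set T}) m : m <= #|A| ->
  exists2 B : {set T}, B \subset A & #|B| = m.
Proof.
move=> mA; have ut : uniq (take m (enum A)) by rewrite take_uniq ?enum_uniq.
exists [set x in take m (enum A)].
  by apply/subsetP => x; rewrite inE => /mem_take; rewrite mem_enum.
rewrite cardsE (card_uniqP ut) size_take -cardE.
by case: ltnP => // Am; apply/eqP; rewrite eqn_leq mA Am.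
Qed.

Section Degrees.
Variable G : sgraph.

Lemma min_degree_le (x : G) : min_degree G <= degree x.
Proof.
rewrite /min_degree; have := mem_index_enum x; elim: (index_enum _) => // y s IH.
rewrite in_cons big_cons => /orP[/eqP ->|/IH]; first exact: geq_minl.
by apply: leq_trans; exact: geq_minr.
Qed.

Lemma min_degree_gt0 : 0 < #|G| -> (forall x : G, 0 < degree x) -> 0 < min_degree G.
Proof.
move=> G0 d0; rewrite /min_degree; elim/big_ind: _ => // a b a0 b0.
by rewrite leq_min a0.
Qed.

Lemma connected_degree_gt0 (x : G) : connected_graph G -> 1 < #|G| -> 0 < degree x.
Proof.
move=> [_ conn] G1; rewrite lt0n; apply/negP; rewrite cards_eq0 => /eqP/setP x0.
have [y yx] : exists y, y != x.
  have : 0 < #|[set~ x]| by rewrite cardsC1; lia.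
  by case/card_gt0P => y; rewrite !inE; exists y.
have cl : closed (@adj G) (pred1 x).
  have h a b : adj a b -> a == x -> b == x.
    by move=> ab /eqP ax; have := x0 b; rewrite !inE -ax ab.
  by move=> a b ab; apply/idP/idP; apply: h; rewrite // adj_sym.
by have := closed_connect cl (conn x y); rewrite !inE eqxx (negPf yx).
Qed.

Lemma degree_isolated_outside (S : {set G}) x :
  x \in isolated_outside S -> degree x <= #|S|.
Proof.
rewrite inE => /andP[_ /forallP h]; apply/subset_leq_card/subsetP => y.
by rewrite inE => /(implyP (h y)).
Qed.

Lemma isolated_outsideN (S : {set G}) x : x \in isolated_outside S -> x \notin S.
Proof. by rewrite !inE => /andP[]. Qed.

(** Vertices of [I] have at most [#|S|] neighbours, vertices of [S] at most all
    others, and the remaining ones have none in [I]. *)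
Lemma sum_degrees_le (S I : {set G}) : I \subset isolated_outside S ->
  \sum_(u : G) degree u <=
    #|I| * #|S| + #|S| * (#|G| - 1) + (#|G| - #|S| - #|I|) * (#|G| - 1 - #|I|).
Proof.
move=> IS; have IS' u : u \in I -> u \notin S.
  by move/(subsetP IS)/isolated_outsideN.
rewrite (bigID [in I]) /= (bigID [in S] [predC I]) /= addnA !leq_add //.
- rewrite -sum_nat_const; apply: leq_sum => u uI.
  exact/degree_isolated_outside/(subsetP IS).
- rewrite (eq_bigl [in S]) => [|u]; last first.
    by rewrite andb_idl // => uS; apply: contraL uS; exact: IS'.
  rewrite -sum_nat_const; apply: leq_sum => u _.
  rewrite subn1 -(cardsC1 u); apply/subset_leq_card/subsetP => v; rewrite !inE.
  by apply: contraTneq => ->; rewrite adj_irrefl.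
apply: (@leq_trans (\sum_(u in ~: (I :|: S)) (#|G| - 1 - #|I|))).
  rewrite (eq_bigl [in ~: (I :|: S)]) => [|u]; last by rewrite !inE negb_or.
  apply: leq_sum => u; rewrite !inE negb_or => /andP[uI uS].
  have -> : #|G| - 1 - #|I| = #|~: (u |: I)|.
    by rewrite [RHS]cardsCs setCK cardsU1 uI; lia.
  apply/subset_leq_card/subsetP => v; rewrite !inE negb_or => uv; apply/andP; split.
    by apply: contraTneq uv => ->; rewrite adj_irrefl.
  apply: contra uS => /(subsetP IS); rewrite inE => /andP[_ /forallP/(_ u)/implyP].
  by apply; rewrite adj_sym.
rewrite sum_nat_const leq_mul2r [#|~: _|]cardsCs setCK cardsU (_ : I :&: S = set0) ?cards0.
  by apply/orP; right; rewrite subn0 -subnDA [X in _ - X]addnC.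
by apply/setP => x; rewrite !inE; apply/negP => /andP[/IS'/negP].
Qed.
End Degrees.

Section Extremal.
Variables d m t : nat.

Definition split_join : sgraph :=
  join_graph (complete_graph d) (union_graph (complete_graph m) (edgeless_graph t)).

(** [Some true] stands for the dominating vertices, [Some false] for the other
    vertices of the clique, and [None] for the independent vertices. *)
Definition part (u : split_join) : option bool :=
  match u with
  | inl _ => Some true
  | inr (inl _) => Some false
  | inr (inr _) => None
  end.

Lemma adj_split_join (u v : split_join) : adj u v = (u != v) &&
  [|| part u == Some true, part v == Some true |
      (part u == Some false) && (part v == Some false)].
Proof.
by case: u => [a|[a|a]]; case: v => [b|[b|b]] //=;
  rewrite ?andbT ?andbF //= /complete_adj ?orbT ?orbF ?andbT.
Qed.

Lemma card_part i : #|[pred u | part u == i]| =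
  match i with Some true => d | Some false => m | None => t end.
Proof.
rewrite -sum1_card big_mkcond !big_sumType /= !sum_nat_const !card_ord.
by case: i => [[]|] /=; lia.
Qed.
End Extremal.

Lemma part_preserves_adj d m t (G : sgraph) (S I : {set G}) (f : G -> split_join d m t) :
  I \subset isolated_outside S -> injective f ->
  (forall x, part (f x) = if x \in S then Some true else if x \in I then None else Some false) ->
  forall x y, adj x y -> adj (f x) (f y).
Proof.
move=> IS fi fc x y xy; rewrite adj_split_join (inj_eq fi) !fc; apply/andP; split.
  by apply: contraTneq xy => ->; rewrite adj_irrefl.
have out u v : adj u v -> u \in I -> v \in S.
  move=> uv /(subsetP IS); rewrite inE => /andP[_ /forallP/(_ v)/implyP]; exact.
case: ifP => //= xS; case: ifP => [xI|xI]; first by rewrite (out x y) // ?eqxx ?orbT.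
case: ifP => //= yS; case: ifP => [yI|//].
by move: xS; rewrite (out y x) // adj_sym.
Qed.

(** Match the parts of the two graphs; since they are not isomorphic, some edge
    of the join is missing in [G]. *)
Lemma q_radius_lt_extremal (R : realType) (G : sgraph) d m t (S I : {set G}) :
  connected_graph G -> I \subset isolated_outside S -> #|S| = d -> #|I| = t ->
  #|G| = d + m + t -> ~ isomorphic G (split_join d m t) ->
  (q_radius R G < q_radius R (split_join d m t))%R.
Proof.
move=> conn IS cS cI cG niso.
have IS' u : u \in S -> u \notin I.
  by apply: contraL => /(subsetP IS)/isolated_outsideN.
pose c (x : G) := if x \in S then Some true else if x \in I then None else Some false.
have [|f bf fc] := @bijection_of_fibres G (split_join d m t) _ c (@part d m t).
  move=> i; rewrite card_part.
  have cSE : #|[pred x | c x == Some true]| = d.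
    by rewrite -cS; apply: eq_card => x; rewrite !inE /c; case: ifP => // _; case: ifP.
  have cIE : #|[pred x | c x == None]| = t.
    rewrite -cI; apply: eq_card => x; rewrite !inE /c; case: ifP => [/IS'/negPf -> //|_].
    by case: ifP.
  case: i => [[]|] //.
  have -> : #|[pred x | c x == Some false]| = #|~: (S :|: I)|.
    apply: eq_card => x; rewrite !inE /c negb_or; case: ifP => //= _; by case: ifP.
  rewrite cardsCs setCK cardsU (_ : S :&: I = set0) ?cards0; first by lia.
  by apply/setP => x; rewrite !inE; apply/negP => /andP[/IS'/negP].
have hom := part_preserves_adj IS (bij_inj bf) fc.
have [/existsP[a /existsP[b /andP[fab nab]]]|/existsPn no] :=
    boolP [exists a, exists b, adj (f a) (f b) && ~~ adj a b].
  exact: (q_radius_lt_supergraph R conn bf hom fab nab).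
case: niso; exists f => // x y; apply/idP/idP; last exact: hom.
by move/existsPn/(_ y): (no x); rewrite negb_and negbK => /orP[/negPf -> //|-> _].
Qed.

Local Open Scope ring_scope.

(** The first two parts form a clique, joined to the independent vertices. *)
Lemma q_radius_split_join_gt (R : realType) d m t : (0 < d)%N -> (0 < t)%N ->
  2 * ((d + m)%:R - 1) < q_radius R (split_join d m t).
Proof.
case: d t => // d [//|t] _ _; pose H := split_join d.+1 m t.+1.
pose A : {set H} := [set u | part u != None].
have -> : (d.+1 + m)%N = #|A|.
  have := cardsC A; have -> : #|~: A| = #|[pred u : H | part u == None]|.
    by apply: eq_card => u; rewrite !inE negbK.
  by rewrite card_part card_sum card_ord card_sum !card_ord; lia.
apply: q_radius_gt_clique.
  by exists (inl ord0), (inr (inr ord0)); split; rewrite ?inE.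
move=> a b; rewrite !inE adj_split_join => pa pb ->.
by case: (part a) pa => [[]|] // _; case: (part b) pb => [[]|] // _.
Qed.

Theorem theorem1p2 (R : realType) (k r n d : nat) (G : sgraph)
  (r_gt0 : (0 < r)%N) (lt_rk : (r < k)%N)
  (G_conn : connected_graph G) (G_order : #|G| = n) (G_mindeg : min_degree G = d)
  (n_large : n%:R >=
     Num.max
       ((k%:R + r%:R) * (k%:R + 2 * r%:R) * (k%:R * d%:R + k%:R + r%:R)
          / (k%:R ^+ 2 * r%:R))
       (((k%:R ^+ 2 + 2 * k%:R * r%:R) * d%:R ^+ 2
          + (2 * k%:R ^+ 2 + 3 * k%:R * r%:R + 2 * r%:R ^+ 2) * d%:R
          + k%:R ^+ 2 + 3 * k%:R * r%:R)
          / (2 * r%:R * (k%:R - r%:R))) :> R)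
  (q_large : q_radius R G >= q_radius R (extremal_graph k r n d)) :
  ~ isomorphic G (extremal_graph k r n d) ->
  has_factor (cycle_tree_family k r) G.
Proof.
move=> niso.
have [/forallP allS|/forallPn[S]] := boolP [forall S : {set G}, isolated_bound k r S].
  exact: isolated_bound_factor.
rewrite isolated_boundE // -ltnNge => bigI; exfalso.
have r0 : 0 < r%:R :> R by rewrite ltr0n.
have rk : r%:R < k%:R :> R by rewrite ltr_nat.
(* both lower bounds on n depend on k and r only through their quotient *)
pose tau : R := k%:R / r%:R.
have kE : k%:R = tau * r%:R by rewrite /tau divfK ?gt_eqF.
have tau1 : 1 < tau by rewrite /tau ltr_pdivlMr ?mul1r.
move: n_large; rewrite ge_max => /andP[n1 n2].
have c1 : (tau + 1) * (tau + 2) * (tau * d%:R + tau + 1) <= tau ^+ 2 * n%:R.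
  move: n1; rewrite ler_pdivrMr; last by rewrite mulr_gt0 // exprn_gt0 // (lt_trans r0).
  rewrite kE => h; rewrite -(ler_pM2r (exprn_gt0 3 r0)); move: h.
  by congr (is_true (_ <= _)); ring.
have c2 : (tau ^+ 2 + 2 * tau) * d%:R ^+ 2 + (2 * tau ^+ 2 + 3 * tau + 2) * d%:R
    + tau ^+ 2 + 3 * tau <= 2 * (tau - 1) * n%:R.
  move: n2; rewrite ler_pdivrMr; last by rewrite !mulr_gt0 ?subr_gt0.
  rewrite kE => h; rewrite -(ler_pM2r (exprn_gt0 2 r0)); move: h.
  by congr (is_true (_ <= _)); ring.
have n_gt1 : (1 < n)%N.
  rewrite -(ltr_nat R) ltNge; apply/negP => nle.
  have d0 := ler0n R d.
  have : 0 <= tau * d%:R by rewrite mulr_ge0 //; lra.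
  have : tau ^+ 2 * n%:R <= tau ^+ 2 * 1 by rewrite ler_wpM2l ?sqr_ge0.
  by nra.
have deg0 (x : G) : (0 < degree x)%N by apply: connected_degree_gt0; rewrite // G_order.
have d0 : (0 < d)%N by rewrite -G_mindeg; apply: min_degree_gt0 => //; exact: G_conn.1.
have [x xI] : exists x, x \in isolated_outside S.
  by apply/card_gt0P; move: bigI; case: #|isolated_outside S| => //; rewrite muln0.
have dS : (d <= #|S|)%N.
  by rewrite -G_mindeg; apply: leq_trans (min_degree_le x) (degree_isolated_outside xI).
(* the number of isolated vertices that S is certain to leave *)
pose p := ((k * #|S|) %/ r + 1)%N.
have [|I IS cI] := @exists_subset_card _ (isolated_outside S) p.
  by rewrite /p addn1 ltn_divLR // mulnC [X in (_ < X)%N]mulnC; move: bigI; rewrite mulnC.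
have spn : (#|S| + p <= n)%N.
  have SI : S :&: I = set0.
    apply/setP => y; rewrite !inE; apply/negP => /andP[yS /(subsetP IS)/isolated_outsideN].
    by rewrite yS.
  by rewrite -cI -G_order -(subn0 (_ + _)%N) -(cards0 G) -SI -cardsU; apply: max_card.
have [sd|sd] := eqVneq #|S| d.
  have : (q_radius R G < q_radius R (extremal_graph k r n d)).
    apply: (q_radius_lt_extremal R G_conn IS) => //.
      by rewrite cI /p sd.
    by rewrite G_order; move: spn; rewrite /p sd; clear; lia.
  by rewrite ltNge q_large.
have ds : (d < #|S|)%N by rewrite ltn_neqAle eq_sym sd.
pose p0 := ((k * d) %/ r + 1)%N.
have tsp : tau * #|S|%:R < p%:R.
  rewrite /tau mulrAC ltr_pdivrMr // -!natrM ltr_nat -ltn_divLR // /p addn1 //.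
have p0d : p0%:R <= tau * d%:R + 1.
  rewrite /p0 natrD lerD2r /tau mulrAC ler_pdivlMr // -!natrM ler_nat.
  exact: leq_trunc_div.
have p0p : (p0 <= p)%N by rewrite /p0 /p leq_add2r leq_div2r // leq_mul2l ltnW ?orbT.
have key := size_bound tau1 d0 ds spn tsp p0d c1 c2.
have n1' : 0 < n%:R - 1 :> R by rewrite subr_gt0 ltr1n.
have qub := @q_radius_le_size R G; rewrite G_order in qub; have {}qub := qub n_gt1 deg0.
have qlb : 2 * ((n - p0)%:R - 1) < q_radius R (extremal_graph k r n d).
  have t0 : (0 < (k * d) %/ r + 1)%N by rewrite addn1.
  apply: le_lt_trans (@q_radius_split_join_gt R d (n - (k * d) %/ r - d - 1) _ d0 t0).
  have -> : (n - p0)%N = (d + (n - (k * d) %/ r - d - 1))%N; last exact: lexx.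
  move: spn ds p0p; rewrite /p0; clear; move: (_ %/ _)%N p #|S| => t0 p' s; lia.
have dsum : (\sum_(u : G) degree u)%:R <= (n%:R - p%:R) * (n%:R - p%:R - 1) + 2 * p%:R * #|S|%:R :> R.
  have := sum_degrees_le IS; rewrite -(ler_nat R) cI G_order.
  move/le_trans; apply; rewrite le_eqVlt; apply/orP; left; apply/eqP.
  have S1 : (0 < #|S|)%N := leq_ltn_trans (leq0n d) ds.
  move: spn S1; clear; move: p #|S| => p' s spn s1.
  by rewrite !natrD !natrM !natrB; try lia; ring.
have : (\sum_(u : G) degree u)%:R / (n%:R - 1) <= n%:R - 2 * p0%:R :> R.
  rewrite ler_pdivrMr // mulrC; exact: le_trans dsum key.
have : (n - p0)%:R = n%:R - p0%:R :> R by rewrite natrB //; move: spn p0p; clear; lia.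
move: qub qlb q_large; lra.
Qed.
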